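(* Let $1\le p<\infty$ and let $(\mathbb{X},\|\cdot\|)$ be a Banach space. The space $\mathbb{W}=W^p_{AA}(\mathbb{R},\mathbb{X})\cap\mathcal{L}^\infty(\mathbb{R},\mathbb{X})$ with the norm $\|\cdot\|_{\mathbb{W}}:=\|\cdot\|_\infty$ is a Banach space.
   Context: $\mathcal{L}^p_{loc}(\mathbb{R},\mathbb{X})$ is the set of functions $\mathbb{R}\to\mathbb{X}$ that are $p$-integrable on every compact interval; $\mathcal{L}^\infty(\mathbb{R},\mathbb{X})$ is the space of measurable essentially bounded functions with norm $\|g\|_\infty=\operatorname{ess\,sup}_{t}\|g(t)\|$. The Weyl seminorm of $u\in\mathcal{L}^p_{loc}(\mathbb{R},\mathbb{X})$ is $$\|u\|_{W^p}=\lim_{h\to\infty}\sup_{\theta\in\mathbb{R}}\Big(\frac1h\int_\theta^{\theta+h}\|u(s)\|^p\,ds\Big)^{1/p},$$ and $W^p_B(\mathbb{R},\mathbb{X})$ is the set of $u\in\mathcal{L}^p_{loc}(\mathbb{R},\mathbb{X})$ with $\|u\|_{W^p}<\infty$. $W^p_{AA}(\mathbb{R},\mathbb{X})$ is the set of all $\varphi\in W^p_B(\mathbb{R},\mathbb{X})$ such that every real sequence $\{\gamma'_n\}$ has a subsequence $\{\gamma_n\}$ for which there is a function $\tilde\varphi:\mathbb{R}\to\mathbb{X}$ with $\lim_n\|\varphi(\cdot+\gamma_n)-\tilde\varphi(\cdot)\|_{W^p}=0$ and $\lim_n\|\tilde\varphi(\cdot-\gamma_n)-\varphi(\cdot)\|_{W^p}=0$.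 *)

(* Defs.v *)
From HB Require Import structures.
From mathcomp Require Import all_boot all_order all_algebra.
From mathcomp Require Import all_classical all_reals all_analysis.
From mathcomp Require Import ess_sup_inf.

Set Implicit Arguments.
Unset Strict Implicit.
Unset Printing Implicit Defensive.

Import Order.TTheory GRing.Theory Num.Theory.
Import numFieldNormedType.Exports.

Local Open Scope classical_set_scope.
Local Open Scope ring_scope.

(* Bochner measurability: almost everywhere limit of simple functions.  Borel
   simple functions suffice, since a Lebesgue measurable set differs from a
   Borel set by a negligible set.  For such u the integrals of `|u| `^ p below,
   which the library defines for every nonnegative function as a supremum
   over Borel simple minorants, are the Lebesgue integrals, even if `|u| is
   only Lebesgue measurable. *)
Definition strongly_measurable (R : realType) (X : normedModType R)
    (u : R -> X) : Prop :=
  exists s : nat -> {fimfun R >-> X},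
    (forall n x, measurable (s n @^-1` [set x])) /\
    \forall t \ae (@lebesgue_measure R), s n t @[n --> \oo] --> u t.

Definition Lploc (R : realType) (X : normedModType R) (p : R) : set (R -> X) :=
  [set u | strongly_measurable u /\
    forall a b : R,
      (\int[@lebesgue_measure R]_(s in `[a, b]) (`|u s| `^ p)%:E < +oo)%E].

Definition Linfty_norm (R : realType) (X : normedModType R) (u : R -> X)
    : \bar R :=
  ess_sup (@lebesgue_measure R) (fun t => `|u t|%:E).

Definition Linfty (R : realType) (X : normedModType R) : set (R -> X) :=
  [set u | strongly_measurable u /\ (Linfty_norm u < +oo)%E].

Definition weyl_mean (R : realType) (X : normedModType R) (p : R)
    (u : R -> X) (h : R) : \bar R :=
  ereal_sup (range (fun theta : R =>
    (((h^-1)%R%:E * \int[@lebesgue_measure R]_(s in `[theta, (theta + h)%R])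
                  (`|u s| `^ p)%:E) `^ p^-1)%E)).

(* On Lploc the limit exists in [0, +oo]: h * (weyl_mean p u h) `^ p is
   nondecreasing and subadditive in h. *)
Definition weyl_norm (R : realType) (X : normedModType R) (p : R)
    (u : R -> X) : \bar R :=
  lim (weyl_mean p u h @[h --> +oo]).

Definition WpB (R : realType) (X : normedModType R) (p : R) : set (R -> X) :=
  [set u | Lploc p u /\ (weyl_norm p u < +oo)%E].

(* phi' is taken in Lploc because the Weyl seminorm is only defined there. *)
Definition WpAA (R : realType) (X : normedModType R) (p : R) : set (R -> X) :=
  [set phi | WpB p phi /\
    forall gamma' : nat -> R,
    exists sigma : nat -> nat, {homo sigma : m n / (m < n)%N} /\
    exists phi' : R -> X,
    let gamma n := gamma' (sigma n) in
    [/\ Lploc p phi',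
        weyl_norm p (fun t => phi (t + gamma n) - phi' t)
          @[n --> \oo] --> 0%E
      & weyl_norm p (fun t => phi' (t - gamma n) - phi t)
          @[n --> \oo] --> 0%E]].

Definition WW (R : realType) (X : normedModType R) (p : R) : set (R -> X) :=
  WpAA p `&` @Linfty R X.

(* A set S of functions, with functions equal almost everywhere identified, is
   a Banach space for N: S is a linear subspace of the space of all functions,
   and the quotient of S by almost everywhere equality, with the norm induced
   by N, is a Banach space E with projection q. *)
Definition is_banach_modulo_ae (R : realType) (X : normedModType R)
    (S : set (R -> X)) (N : (R -> X) -> \bar R) : Prop :=
  [/\ S (fun=> 0),
      forall u v, S u -> S v -> S (fun t => u t + v t),
      forall (a : R) u, S u -> S (fun t => a *: u t)
    & exists (E : completeNormedModType R) (q : (R -> X) -> E),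
      [/\ forall u v, S u -> S v -> q (fun t => u t + v t) = q u + q v,
          forall (a : R) u, S u -> q (fun t => a *: u t) = a *: q u,
          forall u v, S u -> S v ->
            (q u = q v <-> \forall t \ae (@lebesgue_measure R), u t = v t),
          forall e : E, exists2 u, S u & q u = e
        & forall u, S u -> `|q u|%:E = N u]].

(* Main.v *)
Require Import Defs.
From HB Require Import structures.
From mathcomp Require Import all_boot all_order all_algebra.
From mathcomp Require Import all_classical all_reals all_analysis.
From mathcomp Require Import measurable_realfun ess_sup_inf.
From mathcomp Require Import ring lra.

(** The space consists of bounded functions with the essential supremum norm,
so an essentially Cauchy sequence [v_k] has a limit [v] almost everywhere,
uniformly off a null set. Such a uniform limit is bounded and strongly
measurable ([strongly_measurable_unif_lim]). The whole difficulty is that [v]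
is again Weyl almost automorphic.

Fix a sequence of reals. A diagonal argument ([diagonal_extraction]) gives one
subsequence [gamma] along which every [v_k] has a limit [v'_k] in the Weyl
seminorm. Since [v_(k+1) - v_k] is bounded by a small [M], the limits are close
too: [v'_(k+1) - v'_k] has Weyl seminorm at most [M]. This does not suffice,
because the space of locally p-integrable functions is not complete for the
Weyl seminorm: a Cauchy sequence of Weyl limits need not converge. What helps
is that more is true. The difference [d = v'_(k+1) - v'_k] is the Weyl limit of
functions with values in the ball of radius [M], and retracting [X] radially
onto that ball moves a point [d t] by no more than the distance from [d t] to
any point of the ball. Hence [d] and its retraction are at Weyl distance 0
([translation_limit_truncate]). Replacing each difference by its retraction
changes the [v'_k] only within their Weyl classes, and the corrected limits
converge uniformly, to a limit for [v] ([translation_limit_ae_limit]).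

Besides completeness of [X], this uses the elementary theory of the Weyl
seminorm. The means over windows of length [h] converge as [h] tends to
infinity by a subadditivity argument ([weyl_mean_cvg]), so that the seminorm
inherits from the means the triangle inequality, invariance under translation,
monotonicity, and the bound by the essential supremum. The integrals involved
are those of Lebesgue measurable functions against a measure on Borel sets;
they are computed on Borel representatives ([power_integral_borel]).

Finally, the quotient by equality almost everywhere is an instance of the
quotient of a seminormed space by the vectors of seminorm 0
([seminorm_quotient_complete]). *)

Set Implicit Arguments.
Unset Strict Implicit.
Unset Printing Implicit Defensive.

Import Order.TTheory GRing.Theory Num.Theory.
Import numFieldNormedType.Exports.

Local Open Scope classical_set_scope.
Local Open Scope ring_scope.

(** * Quotient of a complete seminormed space *)

Lemma half_expn_le (R : realType) (e : R) : 0 < e ->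
  exists n0, forall n, (n0 <= n)%N -> 2^-1 ^+ n <= e.
Proof.
move=> e0; have h1 : `|2^-1 : R| < 1 by rewrite ger0_norm// invf_lt1// ltr1n.
have /cvgrPdist_le/(_ _ e0)[n0 _ hn0] := cvg_expr h1.
by exists n0 => n /hn0/=; rewrite sub0r normrN ger0_norm// exprn_ge0.
Qed.

Section seminorm_quotient.
Variables (R : realType) (V : lmodType R) (S : set V) (N : V -> R).
Hypothesis S0 : S 0.
Hypothesis SD : forall u v, S u -> S v -> S (u + v).
Hypothesis SZ : forall (a : R) u, S u -> S (a *: u).
Hypothesis ND : forall u v, S u -> S v -> N (u + v) <= N u + N v.
Hypothesis NZ : forall (a : R) u, S u -> N (a *: u) = `|a| * N u.

Let SN u : S u -> S (- u).
Proof. by move=> Su; rewrite -scaleN1r; exact: SZ. Qed.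

Let SB u v : S u -> S v -> S (u - v).
Proof. by move=> Su Sv; apply: SD => //; exact: SN. Qed.

Let NN u : S u -> N (- u) = N u.
Proof. by move=> Su; rewrite -scaleN1r NZ// normrN1 mul1r. Qed.

Let N0 : N 0 = 0.
Proof. by rewrite -(scale0r 0) NZ// normr0 mul0r. Qed.

Let N_ge0 u : S u -> 0 <= N u.
Proof.
move=> Su; have := ND Su (SN Su).
by rewrite subrr N0 NN// -mulr2n pmulrn_lge0.
Qed.

Let eqN u v := S v /\ N (u - v) = 0.

(* A vector is represented by a vector chosen in its class. The choice depends
   on the class alone, so equivalent vectors have equal representatives. *)
Let repr u := xget 0 [set v | eqN u v].

Let reprP u : S u -> eqN u (repr u).
Proof.
move=> Su; rewrite /repr; case: xgetP => [v _ //|/(_ u)].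
by case; split => //; rewrite subrr N0.
Qed.

Let N_eq u v : S u -> S v -> N (u - v) = 0 -> N u = N v.
Proof.
move=> Su Sv uv; apply/eqP; rewrite eq_le; apply/andP; split.
  by have := ND (SB Su Sv) Sv; rewrite subrK uv add0r.
have := ND (SB Sv Su) Su; rewrite subrK.
by rewrite -(NN (SB Sv Su)) opprB uv add0r.
Qed.

Let repr_eq u v : S u -> S v -> N (u - v) = 0 -> repr u = repr v.
Proof.
move=> Su Sv uv; rewrite /repr; congr (xget _ _); apply/seteqP.
split=> w [Sw /= uw]; split => //.
- rewrite -(@N_eq (u - w)) //; [exact: SB|exact: SB|].
  by rewrite opprB addrA subrK.
- rewrite -(@N_eq (v - w)) //; [exact: SB|exact: SB|].
  by rewrite opprB addrA subrK -(NN (SB Sv Su)) opprB.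
Qed.

(** The quotient by the vectors of seminorm 0, carried by the chosen
representatives. It is a subtype of [V], hence it inherits choice. *)
Definition seminorm_quot := {v : V | `[< S v /\ repr v = v >]}.

HB.instance Definition _ :=
  Choice.copy seminorm_quot {v : V | `[< S v /\ repr v = v >]}.

Let val_in (e : seminorm_quot) : S (val e).
Proof. by case: e => v /=/asboolP[]. Qed.

Let repr_val (e : seminorm_quot) : repr (val e) = val e.
Proof. by case: e => v /=/asboolP[]. Qed.

Let reprK u : S u -> repr (repr u) = repr u.
Proof.
move=> Su; have [Sr ur] := reprP Su.
by apply: repr_eq => //; rewrite -(NN (SB Sr Su)) opprB.
Qed.

Let class_subproof u : `[< S (repr (if `[< S u >] then u else 0)) /\
  repr (repr (if `[< S u >] then u else 0)) =
  repr (if `[< S u >] then u else 0) >].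
Proof.
apply/asboolP; case: ifPn => [/asboolP Su|_].
  by split; [have [] := reprP Su|exact: reprK].
by split; [have [] := reprP S0|exact: reprK].
Qed.

Definition seminorm_class u : seminorm_quot :=
  exist (fun v => `[< S v /\ repr v = v >]) _ (class_subproof u).

Let val_class u : S u -> val (seminorm_class u) = repr u.
Proof. by move=> Su /=; rewrite ifT//; exact/asboolP. Qed.

Let class_eq u v : S u -> S v -> N (u - v) = 0 ->
  seminorm_class u = seminorm_class v.
Proof.
by move=> Su Sv uv; apply: val_inj; rewrite !val_class//; exact: repr_eq.
Qed.

Let class_val e : seminorm_class (val e) = e.
Proof. by apply: val_inj; rewrite val_class ?repr_val. Qed.

Let class_ind (P : seminorm_quot -> Prop) :
  (forall u, S u -> P (seminorm_class u)) -> forall e, P e.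
Proof. by move=> h e; rewrite -(class_val e); exact: h. Qed.

Let NvalB u : S u -> N (val (seminorm_class u) - u) = 0.
Proof.
move=> Su; have [Sr ur] := reprP Su.
by rewrite val_class// -NN ?opprB//; exact: SB.
Qed.

Definition qadd (e f : seminorm_quot) := seminorm_class (val e + val f).
Definition qopp (e : seminorm_quot) := seminorm_class (- val e).
Definition qscale (a : R) (e : seminorm_quot) := seminorm_class (a *: val e).
Definition qnorm (e : seminorm_quot) := N (val e).

Let qaddE u v : S u -> S v ->
  qadd (seminorm_class u) (seminorm_class v) = seminorm_class (u + v).
Proof.
move=> Su Sv; apply: class_eq; [exact: SD|exact: SD|].
apply/eqP; rewrite eq_le N_ge0 ?andbT; last by apply: SB; exact: SD.
rewrite opprD addrACA (le_trans (ND _ _))//; [exact: SB|exact: SB|].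
by rewrite !NvalB// addr0.
Qed.

Let qscaleE a u : S u -> qscale a (seminorm_class u) = seminorm_class (a *: u).
Proof.
move=> Su; apply: class_eq; [exact: SZ|exact: SZ|].
by rewrite -scalerBr NZ ?NvalB ?mulr0//; exact: SB.
Qed.

Let qoppE u : S u -> qopp (seminorm_class u) = seminorm_class (- u).
Proof.
by move=> Su; rewrite -scaleN1r -qscaleE// /qopp /qscale scaleN1r.
Qed.

Let qnormE u : S u -> qnorm (seminorm_class u) = N u.
Proof. by move=> Su; apply: N_eq => //; rewrite NvalB. Qed.

Let qaddA : associative qadd.
Proof.
elim/class_ind => u Su; elim/class_ind => v Sv; elim/class_ind => w Sw.
by rewrite !qaddE ?addrA//; exact: SD.
Qed.

Let qaddC : commutative qadd.
Proof.
by elim/class_ind => u Su; elim/class_ind => v Sv; rewrite !qaddE// addrC.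
Qed.

Let qadd0 : left_id (seminorm_class 0) qadd.
Proof. by elim/class_ind => u Su; rewrite qaddE// add0r. Qed.

Let qaddN : left_inverse (seminorm_class 0) qopp qadd.
Proof.
by elim/class_ind => u Su; rewrite qoppE// qaddE ?addNr//; exact: SN.
Qed.

HB.instance Definition _ :=
  GRing.isZmodule.Build seminorm_quot qaddA qaddC qadd0 qaddN.

Let classD u v : S u -> S v ->
  seminorm_class (u + v) = seminorm_class u + seminorm_class v.
Proof. by move=> Su Sv; rewrite -qaddE. Qed.

Let qscaleA a b e : qscale a (qscale b e) = qscale (a * b) e.
Proof.
elim/class_ind: e => u Su.
by rewrite !qscaleE ?scalerA//; exact: SZ.
Qed.

Let qscale1 : left_id 1 qscale.
Proof. by elim/class_ind => u Su; rewrite qscaleE// scale1r. Qed.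

Let qscaleDr : right_distributive qscale +%R.
Proof.
move=> a; elim/class_ind => u Su; elim/class_ind => v Sv.
rewrite -classD// !qscaleE ?scalerDr ?classD//; try exact: SZ.
exact: SD.
Qed.

Let qscaleDl e : {morph qscale^~ e : a b / a + b}.
Proof.
elim/class_ind: e => u Su a b.
by rewrite !qscaleE// scalerDl classD//; exact: SZ.
Qed.

HB.instance Definition _ := GRing.Zmodule_isLmodule.Build R seminorm_quot
  qscaleA qscale1 qscaleDr qscaleDl.

Let qnormD e f : qnorm (e + f) <= qnorm e + qnorm f.
Proof.
elim/class_ind: e => u Su; elim/class_ind: f => v Sv.
by rewrite -classD// !qnormE//; [exact: ND|exact: SD].
Qed.

Let qnormZ a e : qnorm (a *: e) = `|a| * qnorm e.
Proof.
elim/class_ind: e => u Su.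
by rewrite [a *: _]qscaleE// !qnormE ?NZ//; exact: SZ.
Qed.

Let qnorm_eq0 e : qnorm e = 0 -> e = 0.
Proof.
elim/class_ind: e => u Su; rewrite qnormE// => u0.
by apply: class_eq => //; rewrite subr0.
Qed.

HB.instance Definition _ := Lmodule_isNormed.Build R seminorm_quot
  qnormD qnormZ qnorm_eq0.

Hypothesis Ncomplete : forall u_ : nat -> V, (forall n, S (u_ n)) ->
  (forall n, N (u_ n.+1 - u_ n) <= 2^-1 ^+ n) ->
  exists2 u, S u & forall e, 0 < e ->
    exists n0, forall n, (n0 <= n)%N -> N (u_ n - u) <= e.

Let classN u : S u -> - seminorm_class u = seminorm_class (- u).
Proof. by move=> Su; rewrite -qoppE. Qed.

Let norm_class u : S u -> `|seminorm_class u| = N u.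
Proof. by move=> Su; rewrite -qnormE. Qed.

Let classB u v : S u -> S v ->
  `|seminorm_class u - seminorm_class v| = N (u - v).
Proof.
move=> Su Sv; have SNv := SN Sv.
by rewrite classN// -classD// norm_class//; exact: SB.
Qed.

Let quot_complete (F : set_system seminorm_quot) :
  ProperFilter F -> cauchy F -> cvg F.
Proof.
move=> FF /cauchyP Fc.
(* The centres of balls of the filter with geometrically decreasing radii form
   a sequence to which the hypothesis of completeness applies. The radii are
   chosen so that consecutive balls, which meet, have centres within 2^-n. *)
have e_gt0 n : 0 < 2^-1 ^+ n.+2 :> R by rewrite exprn_gt0.
have /choice[x_ Fx] (n : nat) :
    exists x : seminorm_quot, F (ball x (2^-1 ^+ n.+2)).
  exact: Fc.
have x_close n : `|x_ n.+1 - x_ n| <= 2^-1 ^+ n.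
  have [y []] := filter_ex (filterI (Fx n) (Fx n.+1)).
  rewrite -!ball_normE/= => y1 y2.
  rewrite -(subrK y (x_ n.+1)) -addrA (le_trans (ler_normD _ _))//.
  rewrite (distrC y) (le_trans (lerD (ltW y2) (ltW y1)))//.
  have : 0 < 2^-1 ^+ n :> R by rewrite exprn_gt0.
  by rewrite !(exprS _ n.+2) !(exprS _ n.+1) !(exprS _ n); lra.
have [] := Ncomplete (fun n => val_in (x_ n)).
  by move=> n; rewrite -classB// !class_val.
move=> u Su xu; apply/cvg_ex; exists (seminorm_class u).
apply/cvgrPdist_le => e e0.
have [|n0 hn0] := xu (e / 2); first by rewrite divr_gt0.
have [|n1 hn1] := @half_expn_le R (e / 2); first by rewrite divr_gt0.
pose n := maxn n0 n1.
near=> y.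
rewrite -(subrK (x_ n) (seminorm_class u)) -addrA (le_trans (ler_normD _ _))//.
rewrite -(class_val (x_ n)) distrC classB// class_val.
rewrite [leRHS](splitr e) lerD ?hn0 ?leq_maxl//.
apply/ltW/(@lt_le_trans _ _ (2^-1 ^+ n.+2)); last first.
  by rewrite hn1// -addn2 (leq_trans (leq_maxr n0 n1))// leq_addr.
by near: y; have := Fx n; rewrite -ball_normE.
Unshelve. all: by end_near. Qed.

HB.instance Definition _ :=
  Uniform_isComplete.Build seminorm_quot quot_complete.

(** Completeness is asked of the sequences whose n-th step is at most 2^-n:
the limit of such a sequence, chosen along a Cauchy filter, is a limit of the
filter. *)
Lemma seminorm_quotient_complete :
  exists (E : completeNormedModType R) (q : V -> E),
  [/\ forall u v, S u -> S v -> q (u + v) = q u + q v,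
      forall (a : R) u, S u -> q (a *: u) = a *: q u,
      forall e, exists2 u, S u & q u = e
    & forall u, S u -> `|q u| = N u].
Proof.
exists seminorm_quot, seminorm_class; split.
- exact: classD.
- by move=> a u Su; rewrite -qscaleE.
- by move=> e; exists (val e) => //; exact: class_val.
- exact: norm_class.
Qed.
End seminorm_quotient.

(** * Strong measurability *)

Section lebesgue_ae.
Variable R : realType.
Local Notation mu := (@lebesgue_measure R).

Lemma ae_imply (P Q : R -> Prop) : (forall t, P t -> Q t) ->
  (\forall t \ae mu, P t) -> \forall t \ae mu, Q t.
Proof. exact: (@filterS _ _ (ae_filter_ringOfSetsType mu)). Qed.

Lemma ae_imply2 (P Q S : R -> Prop) : (forall t, P t -> Q t -> S t) ->
  (\forall t \ae mu, P t) -> (\forall t \ae mu, Q t) ->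
  \forall t \ae mu, S t.
Proof. exact: (@filterS2 _ _ (ae_filter_ringOfSetsType mu)). Qed.

End lebesgue_ae.

Section translation.
Variable R : realType.
Local Notation mu := (@lebesgue_measure R).

Lemma measurable_shift (c : R) :
  measurable_fun [set: R] (fun t : R => t + c).
Proof. exact: measurable_funD. Qed.

(** The image of Lebesgue measure under a translation gives every interval its
length, which characterizes Lebesgue measure. *)
Lemma lebesgue_measure_shift (c : R) (A : set R) : measurable A ->
  pushforward mu (fun t : R => t + c : measurableTypeR R) A = mu A.
Proof.
move=> mA.
have mshift := measurable_shift c.
apply/esym/lebesgue_measure_unique => // _ [[a b]] _ <-.
rewrite /pushforward/=.
rewrite [X in _ = mu X](_ : _ = `](a - c)%R, (b - c)%R]%classic); last first.
  by apply/seteqP; split => t /=; rewrite !in_itv/= ltrBlDr lerBrDr.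
rewrite !lebesgue_measure_itv/= !lte_fin ltrD2r; case: ifP => // _.
by rewrite -!EFinB; congr EFin; ring.
Qed.

Lemma ae_shift (c : R) (P : R -> Prop) :
  (\forall t \ae mu, P t) -> \forall t \ae mu, P (t + c).
Proof.
move=> [A [mA A0 PA]]; exists ((fun t => t + c) @^-1` A); split.
- by rewrite -[X in measurable X]setTI; exact: measurable_shift.
- by rewrite -[LHS]/(pushforward mu (fun t : R => t + c : measurableTypeR R) A)
             lebesgue_measure_shift.
- by move=> t /= nP; exact: PA.
Qed.

End translation.

Section simple.
Variable R : realType.

(** The Borel simple functions of the definition of strong measurability, as a
predicate on plain functions. *)
Definition is_simple (T : Type) (f : R -> T) :=
  finite_set (range f) /\ forall x, measurable (f @^-1` [set x]).

Lemma simple_preimage (T : Type) (f : R -> T) (B : set T) :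
  is_simple f -> measurable (f @^-1` B).
Proof.
move=> [finf mf].
rewrite (_ : _ @^-1` _ = \bigcup_(x in range f `&` B) f @^-1` [set x]).
  by apply: fin_bigcup_measurable => //; exact: finite_setIl.
apply/seteqP; split => [t Bft|t [_ [[s _ <-] Bfs]] /= ->]//.
by exists (f t).
Qed.

Lemma simple_cst (T : Type) (x : T) : is_simple (fun=> x).
Proof.
split; first by apply: (sub_finite_set _ (finite_set1 x)) => _ [_ _ <-].
by move=> y; rewrite preimage_cst; case: ifP => _.
Qed.

Lemma simple_if (T : Type) (A : set R) (f g : R -> T) :
  measurable A -> is_simple f -> is_simple g ->
  is_simple (fun t => if `[< A t >] then f t else g t).
Proof.
move=> mA sf sg; split.
  apply: (@sub_finite_set _ _ (range f `|` range g)).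
    by move=> _ [t _ <-]; case: ifP => _; [left|right]; exists t.
  by rewrite finite_setU; split; [exact: sf.1|exact: sg.1].
move=> x; rewrite (_ : _ @^-1` _ =
  (A `&` f @^-1` [set x]) `|` (~` A `&` g @^-1` [set x])).
  apply: measurableU; apply: measurableI => //; [exact: sf.2| |exact: sg.2].
  exact: measurableC.
apply/seteqP; split => t /=.
  by case: ifP => [/asboolP|/asboolP]; [left|right].
by move=> [[At]|[At]]; case: ifP => [/asboolP|/asboolP].
Qed.

Lemma simple_comp (T U : Type) (G : T -> U) (f : R -> T) :
  is_simple f -> is_simple (fun t => G (f t)).
Proof.
move=> sf; split; last first.
  by move=> x; rewrite -[X in measurable X]/(f @^-1` (G @^-1` [set x]));
     exact: simple_preimage.
apply: (@sub_finite_set _ _ (G @` range f)); last exact/finite_image/sf.1.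
by move=> _ [t _ <-]; exists (f t) => //; exists t.
Qed.

Lemma simple_pair (T U : Type) (f : R -> T) (g : R -> U) :
  is_simple f -> is_simple g -> is_simple (fun t => (f t, g t)).
Proof.
move=> sf sg; split.
  apply: (@sub_finite_set _ _ (range f `*` range g)).
    by move=> _ [t _ <-]; split; exists t.
  by apply: finite_setX; [exact: sf.1|exact: sg.1].
move=> [x y]; rewrite (_ : _ @^-1` _ = f @^-1` [set x] `&` g @^-1` [set y]).
  by apply: measurableI; [exact: sf.2|exact: sg.2].
by apply/seteqP; split => t /= => [[<- <-]|[<- <-]].
Qed.

Lemma simple_shift (T : Type) (f : R -> T) c :
  is_simple f -> is_simple (fun t => f (t + c)).
Proof.
move=> sf; split.
  apply: (@sub_finite_set _ _ (range f)); last exact: sf.1.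
  by move=> _ [t _ <-]; exists (t + c).
move=> x; rewrite -[X in measurable X]setTI.
have := measurable_shift c measurableT (sf.2 x); exact.
Qed.

End simple.

Section strong_measurability.
Variable R : realType.
Local Notation mu := (@lebesgue_measure R).

Lemma strongly_measurableP (X : normedModType R) (u : R -> X) :
  strongly_measurable u <-> exists s : nat -> R -> X,
    (forall n, is_simple (s n)) /\ \forall t \ae mu, s n t @[n --> \oo] --> u t.
Proof.
split=> [[s [ms su]]|[s [ms su]]].
  exists s; split => // n; split => //; exact: ms.
pose s' n : {fimfun R >-> X} := fimfun_Sub (mem_set (ms n).1).
by exists s'; split => // n x; exact: (ms n).2.
Qed.

Lemma strongly_measurable_shift (X : normedModType R) (u : R -> X) c :
  strongly_measurable u -> strongly_measurable (fun t => u (t + c)).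
Proof.
move=> /strongly_measurableP[s [ms su]]; apply/strongly_measurableP.
exists (fun n t => s n (t + c)); split; last exact: (ae_shift c su).
by move=> n; exact: simple_shift.
Qed.

Lemma strongly_measurable_cst (X : normedModType R) (x : X) :
  strongly_measurable (fun=> x : X).
Proof.
apply/strongly_measurableP; exists (fun _ _ => x); split.
  by move=> n; exact: simple_cst.
by apply: aeW => t; exact: cvg_cst.
Qed.

Lemma strongly_measurable_comp2 (X Y Z : normedModType R) (G : X * Y -> Z)
    (u : R -> X) (v : R -> Y) : continuous G ->
  strongly_measurable u -> strongly_measurable v ->
  strongly_measurable (fun t => G (u t, v t)).
Proof.
move=> cG /strongly_measurableP[s [ms su]] /strongly_measurableP[r [mr rv]].
apply/strongly_measurableP; exists (fun n t => G (s n t, r n t)); split.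
  by move=> n; apply: (simple_comp G); exact: simple_pair.
apply: ae_imply2 su rv => t su rv.
apply: (@continuous_cvg _ _ _ _ _ (fun n => (s n t, r n t)) G (u t, v t)).
  exact: cG.
exact: cvg_pair su rv.
Qed.

Lemma strongly_measurableD (X : normedModType R) (u v : R -> X) :
  strongly_measurable u -> strongly_measurable v ->
  strongly_measurable (fun t => u t + v t).
Proof.
apply: (@strongly_measurable_comp2 X X X (fun xy => xy.1 + xy.2)).
exact: add_continuous.
Qed.

Lemma strongly_measurableZ (X : normedModType R) (a : R) (u : R -> X) :
  strongly_measurable u -> strongly_measurable (fun t => a *: u t).
Proof.
move=> usm.
apply: (@strongly_measurable_comp2 X X X (fun xy => a *: xy.1) u u _ usm usm).
by move=> xy; apply: cvgZr; exact: cvg_fst.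
Qed.

Lemma strongly_measurableB (X : normedModType R) (u v : R -> X) :
  strongly_measurable u -> strongly_measurable v ->
  strongly_measurable (fun t => u t - v t).
Proof.
move=> usm mv; apply: strongly_measurableD => //.
have -> : (fun t => - v t) = (fun t => -1 *: v t).
  by apply/funext => t; rewrite scaleN1r.
exact: strongly_measurableZ.
Qed.

(** Let [s k] be a sequence of simple functions converging almost everywhere to
[v_ k], and let [v_ k] converge to [v] at the rate 2^-k. Simple functions
converging to [v] are obtained without discarding sets of small measure: at
time [n] and at the point [t], use the largest [k <= n] for which [s k] is
known to have settled within 2^-k at [t] before time [n]. For each [K] the
sequence [s K] settles at [t] eventually, so the [k] used is eventually at
least [K]. *)
Section uniform_limit.
Variables (X : normedModType R) (s : nat -> nat -> R -> X).

Definition settled k m : set R :=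
  [set t | forall j, (m <= j)%N -> `|s k j t - s k m t| <= 2^-1 ^+ k].

Fixpoint settled_value k m t : X :=
  if `[< settled k m t >] then s k m t
  else if m is m'.+1 then settled_value k m' t else 0.

Fixpoint diagonal_value n k t : X :=
  if `[< exists2 m, (m <= n)%N & settled k m t >] then settled_value k n t
  else if k is k'.+1 then diagonal_value n k' t else 0.

Let settled_valueP k n t : (exists2 m, (m <= n)%N & settled k m t) ->
  exists2 m, settled k m t & settled_value k n t = s k m t.
Proof.
elim: n => [|n IH] [m mn Am] /=.
  by move: mn Am; rewrite leqn0 => /eqP -> Am; rewrite asboolT//; exists 0%N.
case: ifPn => [/asboolP ?|/asboolP nA]; first by exists n.+1.
apply: IH; exists m => //; move: mn; rewrite leq_eqVlt ltnS => /predU1P[mE|//].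
by rewrite mE in Am.
Qed.

Let diagonal_valueP n k K t : (K <= k)%N ->
  (exists2 m, (m <= n)%N & settled K m t) ->
  exists k' m, [/\ (K <= k')%N, settled k' m t
    & diagonal_value n k t = s k' m t].
Proof.
elim: k => [|k IH] /=.
  rewrite leqn0 => /eqP -> h; rewrite (asboolT h).
  by have [m Am ->] := settled_valueP h; exists 0%N, m.
move=> Kk h; case: ifPn => [/asboolP h'|/asboolP nA].
  by have [m Am ->] := settled_valueP h'; exists k.+1, m.
apply: IH => //; move: Kk; rewrite leq_eqVlt ltnS => /predU1P[KE|//].
by rewrite KE in h.
Qed.

Hypothesis ms : forall k n, is_simple (s k n).

Let measurable_settled k m : measurable (settled k m).
Proof.
rewrite (_ : settled k m = \bigcap_(j in [set j | (m <= j)%N])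
    (fun t => (s k j t, s k m t)) @^-1`
      [set xy : X * X | `|xy.1 - xy.2| <= 2^-1 ^+ k]).
  apply: bigcap_measurableType => j _.
  by apply: simple_preimage; exact: simple_pair.
by apply/seteqP; split => t; exact.
Qed.

Let simple_settled_value k m : is_simple (settled_value k m).
Proof.
by elim: m => [|m IH] /=; apply: simple_if => //; exact: simple_cst.
Qed.

Lemma simple_diagonal_value n k : is_simple (diagonal_value n k).
Proof.
have m k' : measurable [set t | exists2 m, (m <= n)%N & settled k' m t].
  rewrite (_ : [set t | _] = \bigcup_(m in [set m | (m <= n)%N]) settled k' m).
    exact: bigcup_measurable.
  by apply/seteqP; split => t [m mn Am]; exists m.
by elim: k => [|k IH] /=; apply: (simple_if (m _)) => //; exact: simple_cst.
Qed.

Lemma diagonal_value_cvg (v_ : nat -> X) (v : X) t :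
  (forall k, s k n t @[n --> \oo] --> v_ k) ->
  (forall k, `|v_ k - v| <= 2^-1 ^+ k) ->
  diagonal_value n n t @[n --> \oo] --> v.
Proof.
move=> sv vv.
have settled_dist k m : settled k m t -> `|v_ k - s k m t| <= 2^-1 ^+ k.
  move=> Akm; have h : `|s k n t - s k m t| @[n --> \oo] --> `|v_ k - s k m t|.
    by apply: cvg_norm; apply: cvgB => //; exact: cvg_cst.
  rewrite -(cvg_lim _ h)//; apply: limr_le; first exact: cvgP h.
  by exists m => // j /= /Akm.
apply/cvgrPdist_le => e e0.
have [|K hK] := @half_expn_le R (e / 2); first by rewrite divr_gt0.
have [M AKM] : exists M, settled K M t.
  have /cvgrPdist_le/(_ (2^-1 ^+ K / 2)) := sv K.
  case; first by rewrite divr_gt0// exprn_gt0.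
  move=> M _ hM; exists M => j Mj.
  rewrite -(subrK (v_ K) (s K j t)) -addrA (le_trans (ler_normD _ _))//.
  rewrite [leRHS](splitr (2^-1 ^+ K)) lerD//; last exact: hM M (leqnn M).
  by rewrite distrC; exact: hM.
exists (maxn K M) => // n /=; rewrite geq_max => /andP[Kn Mn].
have [|k [m [Kk Akm ->]]] := @diagonal_valueP n n K t Kn; first by exists M.
rewrite -(subrK (v_ k) v) -addrA (le_trans (ler_normD _ _))//.
rewrite [leRHS](splitr e) lerD//; last first.
  by rewrite (le_trans (settled_dist _ _ Akm))// hK.
by rewrite distrC (le_trans (vv k))// hK.
Qed.

End uniform_limit.

Lemma strongly_measurable_unif_lim (X : normedModType R)
    (v_ : nat -> R -> X) (v : R -> X) :
  (forall k, strongly_measurable (v_ k)) ->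
  (forall k, \forall t \ae mu, `|v_ k t - v t| <= 2^-1 ^+ k) ->
  strongly_measurable v.
Proof.
move=> mv vv.
have /choice[s ms] (k : nat) : exists s : nat -> R -> X,
    (forall n, is_simple (s n)) /\
    \forall t \ae mu, s n t @[n --> \oo] --> v_ k t.
  exact/strongly_measurableP.
apply/strongly_measurableP; exists (fun n => diagonal_value s n n); split.
  by move=> n; apply: simple_diagonal_value => k m; exact: (ms k).1.
have /ae_foralln sv : forall k, \forall t \ae mu,
    s k n t @[n --> \oo] --> v_ k t.
  by move=> k; exact: (ms k).2.
have /ae_foralln {}vv := vv.
by apply: ae_imply2 sv vv => t; exact: diagonal_value_cvg.
Qed.

(** The upper limit of the norms of simple functions is Borel everywhere, while
their limit need not exist on a null set. *)
Lemma strongly_measurable_norm (X : normedModType R) (u : R -> X) :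
  strongly_measurable u -> exists g : R -> R,
  [/\ measurable_fun setT g, forall t, 0 <= g t
    & \forall t \ae mu, `|u t| = g t].
Proof.
move=> /strongly_measurableP[s [ms su]].
pose g t := fine (limn_esup (fun n => `|s n t|%:E)).
exists (fun t => `|g t|); split=> //.
  apply: measurableT_comp => //; apply: measurableT_comp => //.
  apply: measurable_fun_limn_esup => n; apply/measurable_EFinP.
  move=> _ B mB; rewrite setTI.
  exact: (simple_preimage B (simple_comp _ (ms n))).
apply: ae_imply su => t su.
have h : (`|s n t|%:E)%E @[n --> \oo] --> `|u t|%:E.
  by apply: cvg_EFin; [exact: nearW|exact: cvg_norm].
by rewrite /g (cvg_limn_einf_sup h).2/= normr_id.
Qed.

End strong_measurability.

(** * Integrals of powers of the norm over intervals *)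

Section integral_ae.
Context d (T : measurableType d) (R : realType).
Variable mu : {measure set T -> \bar R}.

Import HBNNSimple.

(** The integral of a nonnegative function, measurable or not, is a supremum
over simple minorants, and setting a minorant of [f] to 0 on the
exceptional null set makes it a minorant of [g] without changing its
integral. *)
Lemma ge0_le_integral_ae (D : set T) (f g : T -> \bar R) :
  (forall t, 0 <= f t)%E -> (forall t, 0 <= g t)%E ->
  (\forall t \ae mu, (f t <= g t)%E) ->
  (\int[mu]_(t in D) f t <= \int[mu]_(t in D) g t)%E.
Proof.
move=> f0 g0 [N [mN N0 fgN]].
rewrite !ge0_integralE//; apply: ge_ereal_sup => /= _ [h hf <-].
pose h' := proj_nnsfun h (measurableC mN).
apply: ereal_sup_ubound; exists h' => /=.
  move=> t; rewrite mindicE.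
  have [Nt|Nt] := pselect (N t).
    rewrite memNset ?mulr0; last by move/(_ Nt).
    by rewrite /patch; case: ifP => // _; exact: g0.
  rewrite mem_set// mulr1 (le_trans (hf t))// /patch; case: ifP => // _.
  by apply: contrapT => fg; apply: Nt; exact: fgN.
rewrite -!integralT_nnsfun; apply: ge0_ae_eq_integral => //.
- exact/measurable_EFinP.
- exact/measurable_EFinP.
- by move=> t _; rewrite lee_fin.
- by move=> t _; rewrite lee_fin.
exists N; split => // t /= nh; apply: contrapT => Nt; apply: nh => _.
by rewrite mindicE mem_set// mulr1.
Qed.

Lemma ge0_integral_ae (D : set T) (f g : T -> \bar R) :
  (forall t, 0 <= f t)%E -> (forall t, 0 <= g t)%E ->
  (\forall t \ae mu, f t = g t) ->
  (\int[mu]_(t in D) f t = \int[mu]_(t in D) g t)%E.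
Proof.
move=> f0 g0 fg; apply/eqP; rewrite eq_le; apply/andP.
by split; apply: ge0_le_integral_ae => //; move: fg;
  apply: (@filterS _ _ (ae_filter_ringOfSetsType mu)) => t ->.
Qed.

End integral_ae.

Section power_integral.
Variables (R : realType) (p : R).
Local Notation mu := (@lebesgue_measure R).

Definition power_integral (X : normedModType R) (u : R -> X) (a b : R) :=
  (\int[mu]_(t in `[a, b]) (`|u t| `^ p)%:E)%E.

Variables X : normedModType R.
Implicit Types u v w : R -> X.

Lemma power_integral_ge0 u a b : (0 <= power_integral u a b)%E.
Proof. by apply: integral_ge0 => t _; rewrite lee_fin powR_ge0. Qed.

(** Reduces the integrals of a strongly measurable function to those of a Borel
function, for which additivity and change of variables are available. *)
Lemma power_integral_borel u : strongly_measurable u -> exists g : R -> \bar R,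
  [/\ measurable_fun setT g, forall t, (0 <= g t)%E,
      (\forall t \ae mu, (`|u t| `^ p)%:E = g t)
    & forall a b, power_integral u a b = (\int[mu]_(t in `[a, b]) g t)%E].
Proof.
move=> /strongly_measurable_norm[g [mg g0 ug]].
exists (fun t => (g t `^ p)%:E).
have aeg : \forall t \ae mu, (`|u t| `^ p)%:E = (g t `^ p)%:E.
  by apply: ae_imply ug => t ->.
have gp0 t : (0 <= (g t `^ p)%:E)%E by rewrite lee_fin powR_ge0.
split => //.
  apply/measurable_EFinP; apply: (measurableT_comp (measurable_powR p)) mg.
by move=> a b; apply: ge0_integral_ae => // t; rewrite lee_fin powR_ge0.
Qed.

Lemma power_integral_split u a b c : strongly_measurable u -> a <= b ->
  b <= c ->
  (power_integral u a c <= power_integral u a b + power_integral u b c)%E.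
Proof.
move=> /power_integral_borel[g [mg g0 _ ug]] ab bc; rewrite !ug.
have -> : `[a, c]%classic = `[a, b] `|` `]b, c].
  by rewrite -itv_bndbnd_setU// bnd_simp.
rewrite ge0_integral_setU//.
- rewrite leeD2l// ge0_subset_integral//.
    exact: measurable_funTS.
  by apply: subset_itvr; rewrite bnd_simp.
- exact: measurable_funTS.
- apply/disj_set2P/seteqP; split => // t /=; rewrite !in_itv/=.
  by move=> [/andP[_ tb] /andP[bt _]]; move: (lt_le_trans bt tb); rewrite ltxx.
Qed.

Lemma power_integral_subset u a b a' b' : strongly_measurable u ->
  a' <= a -> b <= b' -> (power_integral u a b <= power_integral u a' b')%E.
Proof.
move=> /power_integral_borel[g [mg g0 _ ug]] aa bb; rewrite !ug.
rewrite ge0_subset_integral//; first exact: measurable_funTS.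
by apply: subset_itv; rewrite bnd_simp.
Qed.

Lemma power_integral_shift u c a b : strongly_measurable u ->
  power_integral (fun t => u (t + c)) a b = power_integral u (a + c) (b + c).
Proof.
move=> /power_integral_borel[g [mg g0 ug uE]]; rewrite uE.
have -> : power_integral (fun t => u (t + c)) a b =
    (\int[mu]_(t in `[a, b]) g ((t : R) + c)%R)%E.
  apply: ge0_integral_ae; last exact: (ae_shift c ug).
    by move=> t; rewrite lee_fin powR_ge0.
  by move=> t; exact: g0.
have -> : `[a, b]%classic =
    (fun t : R => t + c : measurableTypeR R) @^-1` `[a + c, b + c].
  by apply/seteqP; split => t /=; rewrite !in_itv/= !lerD2r.
have mc := measurable_shift c.
rewrite -[LHS](@ge0_integral_pushforward _ _ (measurableTypeR R)
  (measurableTypeR R) R (fun t : R => t + c) mc mu `[a + c, b + c]%classic g)//.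
- apply: eq_measure_integral => A mA _; exact: lebesgue_measure_shift.
- exact: measurable_funTS.
Qed.

(** One inequality covers domination (take [beta = 0]) and Minkowski (take the
coefficients given by convexity of the power). *)
Lemma power_integral_le_lin u v w alpha beta a b :
  strongly_measurable u -> strongly_measurable v ->
  0 <= alpha -> 0 <= beta ->
  (\forall t \ae mu,
    `|w t| `^ p <= alpha * `|u t| `^ p + beta * `|v t| `^ p) ->
  (power_integral w a b <=
   alpha%:E * power_integral u a b + beta%:E * power_integral v a b)%E.
Proof.
move=> /power_integral_borel[f [mf f0 uf ->]].
move=> /power_integral_borel[g [mg g0 vg ->]] a0 b0 wuv.
have mf' := measurable_funTS mf (D := `[a, b]%classic).
have mg' := measurable_funTS mg (D := `[a, b]%classic).
rewrite -!ge0_integralZl_EFin// -ge0_integralD//; first last.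
- exact: measurable_funeM.
- by move=> t _; rewrite mule_ge0.
- exact: measurable_funeM.
- by move=> t _; rewrite mule_ge0.
apply: ge0_le_integral_ae.
- by move=> t; rewrite lee_fin powR_ge0.
- by move=> t; rewrite adde_ge0// mule_ge0.
have := ae_imply2 (fun t => @conj _ _) uf vg.
apply: ae_imply2 wuv => t wuv [<- <-].
by rewrite -!EFinM -EFinD lee_fin.
Qed.

Lemma power_integral_le_cst u M a b : 0 <= p -> a <= b ->
  (\forall t \ae mu, `|u t| <= M) ->
  (power_integral u a b <= (M `^ p * (b - a))%:E)%E.
Proof.
move=> p0 ab uM.
apply: (@le_trans _ _ (\int[mu]_(t in `[a, b]) cst (M `^ p)%:E t)%E).
  apply: ge0_le_integral_ae => [t|t|]; rewrite ?lee_fin ?powR_ge0//.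
  apply: ae_imply uM => t uM; rewrite lee_fin ge0_ler_powR// nnegrE//.
  exact: le_trans uM.
rewrite integral_cst//= lebesgue_measure_itv/= lte_fin.
case: ifPn => [_|]; first by rewrite -EFinB -EFinM.
by rewrite mule0 lee_fin mulr_ge0 ?powR_ge0// subr_ge0.
Qed.

End power_integral.

(** * The Weyl seminorm *)

Section powR_complements.
Variables (R : realType) (p : R).
Hypothesis p1 : 1 <= p.

Let p_gt0 : 0 < p. Proof. exact: lt_le_trans p1. Qed.

Lemma poweR_inv_le (x : \bar R) (r : R) : (0 <= x)%E -> 0 <= r ->
  ((x `^ p^-1 <= r%:E) = (x <= (r `^ p)%:E))%E.
Proof.
have p0 : p != 0 by rewrite gt_eqF.
case: x => [x| |]//; last first.
  by move=> _ r0; rewrite poweRyr ?invr_eq0// !leye_eq.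
rewrite !lee_fin => x0 r0; apply/idP/idP => h.
  have := @ge0_ler_powR _ p (ltW p_gt0) (x `^ p^-1) r.
  rewrite !nnegrE powR_ge0 r0 => /(_ isT isT h).
  by rewrite -powRrM mulVf// powRr1.
have pV : 0 <= p^-1 by rewrite invr_ge0 ltW.
have := @ge0_ler_powR _ p^-1 pV x (r `^ p).
rewrite !nnegrE powR_ge0 x0 => /(_ isT isT h).
by rewrite -powRrM mulfV// powRr1.
Qed.

(** Convexity of the power at the point [(a + b) / (r + s)], which is the
barycentre of [a / r] and [b / s] with weights [r / (r + s)] and
[s / (r + s)]. If the mean p-th powers of [a] and [b] are at most those of
[r] and [s], the right-hand side has mean at most the p-th power of
[r + s]: this is Minkowski's inequality. *)
Lemma powRD_le_lin (a b r s : R) : 0 <= a -> 0 <= b -> 0 < r -> 0 < s ->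
  (a + b) `^ p <= (r + s) `^ p * (r / (r + s) / r `^ p) * a `^ p +
                  (r + s) `^ p * (s / (r + s) / s `^ p) * b `^ p.
Proof.
move=> a0 b0 r0 s0; have rs0 : 0 < r + s by rewrite addr_gt0.
have rsN0 : r + s != 0 by rewrite gt_eqF.
have w0 : 0 <= r / (r + s) by rewrite divr_ge0// ltW.
have w1 : r / (r + s) <= 1 by rewrite ler_pdivrMr// mul1r lerDl ltW.
have := @convex_powR R p p1 (Itv01 w0 w1) (a / r) (b / s).
have [ar0 bs0] : 0 <= a / r /\ 0 <= b / s by rewrite !divr_ge0// ltW.
rewrite !inE/= !in_itv/= !andbT ar0 bs0 => /(_ isT isT).
rewrite !convRE/=.
have -> : unstable.onem (r / (r + s)) = s / (r + s).
  by rewrite /unstable.onem; field.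
have -> : conv (Itv01 w0 w1) (a / r : convex_lmodType R^o) (b / s) =
    (a + b) / (r + s).
  transitivity (r / (r + s) * (a / r) +
      unstable.onem (r / (r + s)) * (b / s)) => //.
  by rewrite /unstable.onem; field; rewrite rsN0 !gt_eqF.
have [rV sV rsV] : [/\ 0 <= r^-1, 0 <= s^-1 & 0 <= (r + s)^-1].
  by rewrite !invr_ge0 !ltW.
rewrite !powRM ?addr_ge0//.
have powV (x : R) : 0 < x -> (x^-1) `^ p = (x `^ p)^-1.
  by move=> x0; rewrite -powRN -(powR_inv1 (ltW x0)) -powRrM mulN1r.
rewrite !powV// ler_pdivrMr ?powR_gt0// => h; apply: (le_trans h).
rewrite le_eqVlt; apply/orP; left; apply/eqP; ring.
Qed.


End powR_complements.

Section weyl.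
Variables (R : realType) (p : R) (X : normedModType R).
Hypothesis p1 : 1 <= p.
Implicit Types u v w : R -> X.

Let p_gt0 : 0 < p. Proof. exact: lt_le_trans p1. Qed.

Lemma weyl_mean_ge0 u h : (0 <= weyl_mean p u h)%E.
Proof.
apply: le_trans (ereal_sup_ubound _); last by exists 0.
exact: poweR_ge0.
Qed.

Lemma weyl_mean_leP u h r : 0 < h -> 0 <= r ->
  (weyl_mean p u h <= r%:E)%E <->
  forall theta, (power_integral p u theta (theta + h) <= (r `^ p * h)%:E)%E.
Proof.
move=> h0 r0.
have E theta : (((h^-1)%:E * power_integral p u theta (theta + h)) `^ p^-1
    <= r%:E)%E = (power_integral p u theta (theta + h) <= (r `^ p * h)%:E)%E.
  rewrite poweR_inv_le//; last first.
    by rewrite mule_ge0 ?power_integral_ge0// lee_fin invr_ge0 ltW.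
  by rewrite mulrC EFinM lee_pdivrMl.
split=> [H theta|H].
  by rewrite -E; apply: le_trans H; apply: ereal_sup_ubound; exists theta.
by apply: ge_ereal_sup => _ [theta _ <-]; rewrite [(_ <= _)%E]E.
Qed.

Lemma weyl_mean_fin u h : (weyl_mean p u h < +oo)%E ->
  exists2 m, 0 <= m & weyl_mean p u h = m%:E.
Proof.
have := weyl_mean_ge0 u h; case: (weyl_mean p u h) => // m.
by rewrite lee_fin => m0 _; exists m.
Qed.

Lemma power_integral_steps u h c (n : nat) theta : strongly_measurable u ->
  0 <= h -> (forall t, (power_integral p u t (t + h) <= c%:E)%E) -> 0 <= c ->
  (power_integral p u theta (theta + n%:R * h) <= (n%:R * c)%:E)%E.
Proof.
move=> usm h0 hc c0; elim: n => [|n IH].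
  by rewrite !mul0r addr0 /power_integral set_itv1 integral_set1.
rewrite -natr1 [X in power_integral _ _ _ X](_ : _ = theta + n%:R * h + h).
  apply: (@le_trans _ _ (power_integral p u theta (theta + n%:R * h) +
    power_integral p u (theta + n%:R * h) (theta + n%:R * h + h))%E).
    by apply: power_integral_split; rewrite ?lerDl ?mulr_ge0.
  by rewrite mulrDl mul1r EFinD leeD.
by ring.
Qed.

(** A window of length [h] is covered by [n] windows of length [h0], where
[n * h0 <= h + h0]. The factor [(h + h0) / h] so obtained stands under a p-th
root and is at least 1, so it is at most its own p-th power. *)
Lemma weyl_mean_comparison u h0 h m : strongly_measurable u -> 0 < h0 ->
  0 < h -> 0 <= m -> (weyl_mean p u h0 <= m%:E)%E ->
  (weyl_mean p u h <= ((1 + h0 / h) * m)%:E)%E.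
Proof.
move=> usm h00 hh m0 /(weyl_mean_leP _ h00 m0) H.
have q0 : 0 <= h0 / h by rewrite divr_ge0// ltW.
have q1 : 0 <= 1 + h0 / h by rewrite addr_ge0.
apply/weyl_mean_leP => //; first by rewrite mulr_ge0.
move=> theta; pose n := (Num.truncn (h / h0)).+1.
have /andP[n1 n2] : h <= n%:R * h0 <= h + h0.
  have /truncn_itv/andP[] : 0 <= h / h0 by rewrite divr_ge0// ltW.
  rewrite -/n ler_pdivlMr// ltr_pdivrMr// => a /ltW ->.
  by rewrite /n -natr1 mulrDl mul1r lerD2r.
apply: (@le_trans _ _ (power_integral p u theta (theta + n%:R * h0))).
  by apply: power_integral_subset; rewrite ?lerD2l.
apply: le_trans (power_integral_steps _ _ usm (ltW h00) H _) _.
  by rewrite mulr_ge0 ?powR_ge0// ltW.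
rewrite lee_fin mulrCA.
apply: (@le_trans _ _ (m `^ p * (h + h0))).
  by rewrite ler_wpM2l ?powR_ge0.
rewrite powRM// (mulrC _ (m `^ p)) -mulrA ler_wpM2l ?powR_ge0//.
have -> : h + h0 = (1 + h0 / h) * h by field; rewrite gt_eqF.
by rewrite (ler_wpM2r (ltW hh))// le1r_powR// lerDl.
Qed.

(** By the comparison of window lengths, the mean for [h] is at most the mean
for a fixed [h0] times a factor that tends to 1 as [h] tends to infinity; hence
the limit is the infimum, as in Fekete's lemma. *)
Lemma weyl_mean_cvg u : strongly_measurable u ->
  weyl_mean p u h @[h --> +oo] -->
  ereal_inf [set weyl_mean p u h | h in [set h | 0 < h]].
Proof.
move=> usm; set L := ereal_inf _.
have Lle h : 0 < h -> (L <= weyl_mean p u h)%E.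
  by move=> h0; apply: ereal_inf_lbound; exists h.
have L0 : (0 <= L)%E.
  by apply: le_ereal_inf_tmp => _ [h _ <-]; exact: weyl_mean_ge0.
have [Loo|] := eqVneq L +oo%E.
  rewrite Loo; apply: cvg_near_cst; near=> h.
  apply/eqP; rewrite -leye_eq -Loo; apply: Lle.
  by near: h; exact: nbhs_pinfty_gt.
rewrite -ltey => Loo.
have Lfin : L \is a fin_num by rewrite ge0_fin_numE.
have key e : 0 < e ->
    \forall h \near +oo, (weyl_mean p u h <= (fine L + e)%:E)%E.
  move=> e0.
  have [_ [h0 h00 <-] Lh0] : exists2 x,
      [set weyl_mean p u h | h in [set h | 0 < h]] x
      & (x < (fine L + e / 2)%:E)%E.
    apply: ereal_inf_lt.
    by rewrite -/L -{1}(fineK Lfin) lte_fin ltrDl divr_gt0.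
  have [m m0 mE] := weyl_mean_fin (lt_trans Lh0 (ltry _)).
  rewrite mE lte_fin in Lh0.
  near=> h.
  have hh : 0 < h by near: h; exact: nbhs_pinfty_gt.
  have hbig : (e / 2)^-1 * (h0 * m) <= h.
    by near: h; apply: nbhs_pinfty_ge; exact: num_real.
  apply: le_trans (weyl_mean_comparison usm h00 hh m0 _) _; first by rewrite mE.
  rewrite lee_fin mulrDl mul1r.
  suff : h0 / h * m <= e / 2 by lra.
  by rewrite mulrAC ler_pdivrMr// -ler_pdivrMl// divr_gt0.
rewrite -(fineK Lfin); apply/fine_cvgP; split.
  have := key 1 ltr01; apply: filterS => h h1.
  by rewrite ge0_fin_numE ?weyl_mean_ge0// (le_lt_trans h1)// ltry.
apply/cvgrPdist_le => e e0; near=> h.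
have hh : 0 < h by near: h; exact: nbhs_pinfty_gt.
have he : (weyl_mean p u h <= (fine L + e)%:E)%E by near: h; exact: key.
have [m m0 mE] := weyl_mean_fin (le_lt_trans he (ltry _)).
have := Lle _ hh; move: he; rewrite /= mE -{2}(fineK Lfin) !lee_fin => h1 h2.
by rewrite ler_norml/=; apply/andP; split; lra.
Unshelve. all: by end_near. Qed.

Lemma weyl_normE u : strongly_measurable u ->
  weyl_norm p u = ereal_inf [set weyl_mean p u h | h in [set h | 0 < h]].
Proof. by move=> /weyl_mean_cvg; apply: cvg_lim. Qed.

Lemma weyl_norm_cvg u : strongly_measurable u ->
  weyl_mean p u h @[h --> +oo] --> weyl_norm p u.
Proof. by move=> usm; rewrite weyl_normE//; exact: weyl_mean_cvg. Qed.

Lemma weyl_norm_ge0 u : strongly_measurable u -> (0 <= weyl_norm p u)%E.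
Proof.
move=> /weyl_normE ->; apply: le_ereal_inf_tmp => _ [h _ <-].
exact: weyl_mean_ge0.
Qed.

Lemma weyl_mean_comp_shift u c h : strongly_measurable u ->
  weyl_mean p (fun t => u (t + c)) h = weyl_mean p u h.
Proof.
move=> usm; congr ereal_sup; apply/seteqP; split => _ [theta _ <-].
  exists (theta + c) => //.
  have := @power_integral_shift R p X u c theta (theta + h) usm.
  by rewrite /power_integral => ->; rewrite [(_ + h + c)%R]addrAC.
exists (theta - c) => //.
have := @power_integral_shift R p X u c (theta - c) (theta - c + h) usm.
by rewrite /power_integral => ->; rewrite subrK addrAC subrK.
Qed.

Lemma weyl_norm_shift u c : strongly_measurable u ->
  weyl_norm p (fun t => u (t + c)) = weyl_norm p u.
Proof.
move=> usm; rewrite /weyl_norm.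
suff -> : weyl_mean p (fun t => u (t + c)) = weyl_mean p u by [].
by apply/funext => h; exact: weyl_mean_comp_shift.
Qed.

Lemma weyl_norm_le_cst u M : strongly_measurable u -> 0 <= M ->
  (\forall t \ae (@lebesgue_measure R), `|u t| <= M) ->
  (weyl_norm p u <= M%:E)%E.
Proof.
move=> usm M0 uM; rewrite weyl_normE//.
apply: (@le_trans _ _ (weyl_mean p u 1)).
  by apply: ereal_inf_lbound; exists 1 => //=.
apply/weyl_mean_leP => // theta.
have := @power_integral_le_cst R p X u M theta (theta + 1) (ltW p_gt0) _ uM.
by rewrite lerDl addrAC subrr add0r; apply.
Qed.

(** Finite means are replaced by strictly larger numbers [r'] and [s'], since
the convexity inequality divides by them. *)
Lemma weyl_meanD u v h : 0 < h -> strongly_measurable u ->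
  strongly_measurable v ->
  (weyl_mean p (fun t => u t + v t)%R h <= weyl_mean p u h + weyl_mean p v h)%E.
Proof.
move=> h0 usm mv.
have [->|uoo] := eqVneq (weyl_mean p u h) +oo%E.
  by rewrite addye ?leey// gt_eqF// (lt_le_trans _ (weyl_mean_ge0 _ _)).
have [->|voo] := eqVneq (weyl_mean p v h) +oo%E.
  by rewrite addey ?leey// gt_eqF// (lt_le_trans _ (weyl_mean_ge0 _ _)).
have [r r0 rE] : exists2 m, 0 <= m & weyl_mean p u h = m%:E.
  by apply: weyl_mean_fin; rewrite ltey uoo.
have [s s0 sE] : exists2 m, 0 <= m & weyl_mean p v h = m%:E.
  by apply: weyl_mean_fin; rewrite ltey voo.
apply/lee_addgt0Pr => e e0; rewrite rE sE -!EFinD.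
pose r' := r + e / 2; pose s' := s + e / 2.
have [r'0 s'0] : 0 < r' /\ 0 < s' by rewrite !ltr_wpDl// divr_gt0.
have [rr' ss' ->] : [/\ r <= r', s <= s' & r + s + e = r' + s'].
  rewrite !lerDl; split; [by rewrite divr_ge0// ltW..|].
  by rewrite /r' /s'; field.
clearbody r' s'.
have [r'_ge0 s'_ge0] := (ltW r'0, ltW s'0).
apply/weyl_mean_leP => //; first by rewrite addr_ge0.
have /(weyl_mean_leP _ h0 r'_ge0) ur : (weyl_mean p u h <= r'%:E)%E.
  by rewrite rE lee_fin.
have /(weyl_mean_leP _ h0 s'_ge0) vs : (weyl_mean p v h <= s'%:E)%E.
  by rewrite sE lee_fin.
move=> theta.
pose alpha := (r' + s') `^ p * (r' / (r' + s') / r' `^ p).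
pose beta := (r' + s') `^ p * (s' / (r' + s') / s' `^ p).
have alpha0 : 0 <= alpha.
  by apply: mulr_ge0; do ?apply: divr_ge0; rewrite ?powR_ge0 ?addr_ge0.
have beta0 : 0 <= beta.
  by apply: mulr_ge0; do ?apply: divr_ge0; rewrite ?powR_ge0 ?addr_ge0.
apply: (@le_trans _ _ (alpha%:E * power_integral p u theta (theta + h) +
   beta%:E * power_integral p v theta (theta + h))%E).
  apply: power_integral_le_lin => //; apply: aeW => t.
  apply: (le_trans _
    (powRD_le_lin p1 (normr_ge0 _) (normr_ge0 _) r'0 s'0)).
  by rewrite ge0_ler_powR ?nnegrE ?addr_ge0 ?ler_normD ?(ltW p_gt0).
apply: (@le_trans _ _
    (alpha%:E * (r' `^ p * h)%:E + beta%:E * (s' `^ p * h)%:E)%E).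
  by apply: leeD; apply: lee_wpmul2l; rewrite ?lee_fin.
rewrite -!EFinM -EFinD lee_fin /alpha /beta.
rewrite le_eqVlt; apply/orP; left; apply/eqP.
have rs : r' + s' != 0 by rewrite gt_eqF// addr_gt0.
have rp : r' `^ p != 0 by rewrite gt_eqF// powR_gt0.
have sp : s' `^ p != 0 by rewrite gt_eqF// powR_gt0.
by field; rewrite rs rp sp.
Qed.

Lemma weyl_normD u v : strongly_measurable u -> strongly_measurable v ->
  (weyl_norm p (fun t => u t + v t)%R <= weyl_norm p u + weyl_norm p v)%E.
Proof.
move=> usm mv.
have muv : strongly_measurable (fun t => u t + v t).
  exact: strongly_measurableD.
have cuv : (weyl_mean p u h + weyl_mean p v h)%E @[h --> +oo] -->
    (weyl_norm p u + weyl_norm p v)%E.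
  apply: cvgeD; [|exact: weyl_norm_cvg|exact: weyl_norm_cvg].
  by apply: ge0_adde_def; rewrite inE weyl_norm_ge0.
rewrite -(cvg_lim _ cuv)//; apply: lee_lim.
- exact: cvgP (weyl_norm_cvg muv).
- exact: cvgP cuv.
near=> h; apply: weyl_meanD => //.
Unshelve. all: by end_near. Qed.

Lemma weyl_norm_dominated K u w : 0 < K -> strongly_measurable u ->
  strongly_measurable w ->
  (\forall t \ae (@lebesgue_measure R), `|w t| <= K * `|u t|) ->
  (weyl_norm p w <= K%:E * weyl_norm p u)%E.
Proof.
move=> K0 usm mw wu.
have cu : (K%:E * weyl_mean p u h)%E @[h --> +oo] --> (K%:E * weyl_norm p u)%E.
  by apply: cvgeZl => //; exact: weyl_norm_cvg.
rewrite -(cvg_lim _ cu)//; apply: lee_lim.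
- exact: cvgP (weyl_norm_cvg mw).
- exact: cvgP cu.
near=> h.
have h0 : 0 < h by near: h; exact: nbhs_pinfty_gt.
have [->|uoo] := eqVneq (weyl_mean p u h) +oo%E.
  by rewrite gt0_muley ?leey// lte_fin.
have [m m0 mE] : exists2 m, 0 <= m & weyl_mean p u h = m%:E.
  by apply: weyl_mean_fin; rewrite ltey uoo.
have /(weyl_mean_leP _ h0 m0) um : (weyl_mean p u h <= m%:E)%E by rewrite mE.
rewrite mE -EFinM; apply/weyl_mean_leP => //; first by rewrite mulr_ge0// ltW.
move=> theta.
apply: (@le_trans _ _ ((K `^ p)%:E * power_integral p u theta (theta + h) +
   0%:E * power_integral p u theta (theta + h))%E).
  apply: power_integral_le_lin; rewrite ?powR_ge0//.
  apply: ae_imply wu => t wu; rewrite mul0r addr0 -powRM ?(ltW K0)//.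
  by rewrite ge0_ler_powR ?nnegrE ?mulr_ge0 ?(ltW K0) ?(ltW p_gt0).
rewrite mul0e adde0 powRM ?(ltW K0)// -mulrA EFinM.
by rewrite lee_wpmul2l// lee_fin powR_ge0.
Unshelve. all: by end_near. Qed.

End weyl.

(** * Radial retraction and rapidly converging sequences *)

Section radial_retraction.
Variables (R : realType) (X : normedModType R) (M : R).
Hypothesis M0 : 0 < M.

Definition radial (x : X) : X := (M / Num.max M `|x|) *: x.

Let max_gt0 (x : X) : 0 < Num.max M `|x|.
Proof. by rewrite lt_max M0. Qed.

Lemma radial_continuous : continuous radial.
Proof.
move=> x; apply: cvgZ; last exact: cvg_id.
apply: cvgM; first exact: cvg_cst.
apply: cvgV; first by rewrite gt_eqF.
have := @cvg_norm _ _ _ (nbhs x) _ id x cvg_id => h.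
have := @continuous_max R X (cst M) (fun y => `|y|) x; apply; last exact: h.
exact: cvg_cst.
Qed.

Lemma radial_le x : `|radial x| <= M.
Proof.
rewrite normrZ ger0_norm; last by rewrite divr_ge0// ltW.
by rewrite mulrAC ler_pdivrMr// ler_wpM2l ?(ltW M0)// le_max lexx orbT.
Qed.

(** For [z] outside the ball, the distance from [z] to its retraction is
[`|z| - M], which no distance from [z] to a point of the ball goes below. *)
Lemma radial_dist w z : `|w| <= M -> `|z - radial z| <= `|z - w|.
Proof.
move=> wM; have [zM|Mz] := leP `|z| M.
  by rewrite /radial max_l// divff ?gt_eqF// scale1r subrr normr0.
rewrite /radial (max_r (ltW Mz)).
have z0 : 0 < `|z| := lt_trans M0 Mz.
rewrite -[X in X - _]scale1r -scalerBl normrZ ger0_norm; last first.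
  by rewrite subr_ge0 ler_pdivrMr// mul1r ltW.
rewrite mulrBl mul1r divfK ?gt_eqF//.
by rewrite (le_trans _ (lerB_dist _ _))// lerB.
Qed.

Lemma strongly_measurable_radial (u : R -> X) : strongly_measurable u ->
  strongly_measurable (fun t => radial (u t)).
Proof.
move=> usm.
apply: (@strongly_measurable_comp2 R X X X (fun xy => radial xy.1) u u) => //.
move=> xy; apply: (@continuous_comp _ _ _ fst radial); first exact: cvg_fst.
exact: radial_continuous.
Qed.

End radial_retraction.

Section rapid_sequences.
Variables (R : realType) (X : normedModType R) (x : nat -> X).
Hypothesis xS : forall n, `|x n.+1 - x n| <= 2^-1 ^+ n.

Lemma rapid_dist n k :
  `|x (n + k)%N - x n| <= 2 * (2^-1 ^+ n) - 2 * (2^-1 ^+ (n + k)).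
Proof.
elim: k => [|k IH]; first by rewrite addn0 !subrr normr0.
rewrite addnS -(subrK (x (n + k)%N) (x _)) -addrA (le_trans (ler_normD _ _))//.
apply: le_trans (lerD (xS _) IH) _.
by rewrite (exprS _ (n + k)); lra.
Qed.

Lemma rapid_dist_le n m : (n <= m)%N -> `|x m - x n| <= 2 * 2^-1 ^+ n.
Proof.
move=> nm; rewrite -(subnKC nm) (le_trans (rapid_dist _ _))// gerBl.
by rewrite mulr_ge0// exprn_ge0.
Qed.

End rapid_sequences.

Lemma rapid_cvg (R : realType) (X : completeNormedModType R) (x : nat -> X) :
  (forall n, `|x n.+1 - x n| <= 2^-1 ^+ n) ->
  cvgn x /\ forall n, `|x n - limn x| <= 2 * 2^-1 ^+ n.
Proof.
move=> xS.
have xc : cvgn x.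
  apply: cauchy_cvg; apply/cauchyP => e e0.
  have [|n0 hn0] := @half_expn_le R (e / 4); first by rewrite divr_gt0.
  exists (x n0); exists n0 => // m /= n0m; rewrite -ball_normE/= distrC.
  apply: le_lt_trans (rapid_dist_le xS n0m) _.
  by have := hn0 n0 (leqnn _); lra.
split => // n.
have h : `|x n - x m| @[m --> \oo] --> `|x n - limn x|.
  by apply: cvg_norm; apply: cvgB => //; exact: cvg_cst.
rewrite -(cvg_lim _ h)//; apply: limr_le; first exact: cvgP h.
by exists n => // m /= nm; rewrite distrC; exact: rapid_dist_le.
Qed.

(** * Extraction of subsequences and essential boundedness *)

Section vanishing.
Variable R : realType.

Definition vanishing (a : nat -> \bar R) :=
  forall e : R, 0 < e -> exists n0, forall n, (n0 <= n)%N -> (a n <= e%:E)%E.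

Lemma cvge0P (a : nat -> \bar R) : (forall n, 0 <= a n)%E ->
  a n @[n --> \oo] --> 0%E <-> vanishing a.
Proof.
move=> a0; split=> [/fine_cvgP[afin /cvgrPdist_le a_cvg] e e0|av].
  have [n0 _ hn0] := filterI afin (a_cvg e e0).
  exists n0 => n /hn0[/= fa]; rewrite sub0r normrN -{2}(fineK fa) lee_fin.
  by apply: le_trans; exact: ler_norm.
apply/fine_cvgP; split.
  have [n0 hn0] := av 1 ltr01; exists n0 => // n /= /hn0 an.
  by rewrite ge0_fin_numE// (le_lt_trans an)// ltry.
apply/cvgrPdist_le => e /av[n0 hn0]; exists n0 => // n /= /hn0 an.
have fa : a n \is a fin_num by rewrite ge0_fin_numE// (le_lt_trans an)// ltry.
rewrite sub0r normrN ger0_norm ?fine_ge0//.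
by rewrite -lee_fin fineK.
Qed.

(** The reparametrization is the one by which the diagonal of an extraction
compares with each of the extracted sequences. *)
Lemma vanishing_tail (a b : nat -> \bar R) (tau : nat -> nat) N :
  (forall n, (N <= n)%N -> (n <= tau n)%N /\ b n = a (tau n)) ->
  vanishing a -> vanishing b.
Proof.
move=> ab av e /av[n0 hn0]; exists (maxn N n0) => n.
rewrite geq_max => /andP[/ab[ntau ->] n0n].
by apply: hn0; exact: leq_trans ntau.
Qed.

Lemma vanishingD (a b c : nat -> \bar R) :
  (forall n, c n <= a n + b n)%E -> vanishing a -> vanishing b -> vanishing c.
Proof.
move=> cab av bv e e0; have e2 : 0 < e / 2 by rewrite divr_gt0.
have [n0 hn0] := av _ e2; have [n1 hn1] := bv _ e2.
exists (maxn n0 n1) => n; rewrite geq_max => /andP[/hn0 an /hn1 bn].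
by rewrite (le_trans (cab n))// (splitr e) EFinD leeD.
Qed.

Lemma vanishingZ (K : R) (a b : nat -> \bar R) : 0 < K ->
  (forall n, b n <= K%:E * a n)%E -> vanishing a -> vanishing b.
Proof.
move=> K0 ba av e e0; have [|n0 hn0] := av (K^-1 * e).
  by rewrite mulr_gt0 ?invr_gt0.
exists n0 => n /hn0 an; rewrite (le_trans (ba n))//.
by rewrite -lee_pdivlMl// -EFinM.
Qed.

End vanishing.

Lemma increasing_leq (s : nat -> nat) n :
  {homo s : m n / (m < n)%N} -> (n <= s n)%N.
Proof.
by move=> sS; elim: n => // n IH; apply: leq_ltn_trans IH (sS _ _ (ltnSn n)).
Qed.

(** The diagonal sequence is, from the k-th term on, a subsequence of the
sequence extracted for the k-th property, up to a reparametrization by indices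
tending to infinity. *)
Lemma diagonal_extraction (T : Type) (P : nat -> (nat -> T) -> Prop) :
  (forall k g, exists s : nat -> nat,
    {homo s : m n / (m < n)%N} /\ P k (g \o s)) ->
  (forall k g g' (tau : nat -> nat) N, P k g ->
    (forall n, (N <= n)%N -> (n <= tau n)%N /\ g' n = g (tau n)) -> P k g') ->
  forall g, exists s : nat -> nat, {homo s : m n / (m < n)%N} /\
    forall k, P k (g \o s).
Proof.
move=> Pex Psub g.
have /choice[s sP] (kg : nat * (nat -> T)) : exists s : nat -> nat,
    {homo s : m n / (m < n)%N} /\ P kg.1 (kg.2 \o s) by exact: Pex.
(* Each extraction refines the sequence obtained from the previous ones. *)
pose S := fix S k : nat -> nat := if k is k'.+1
  then S k' \o s (k, g \o S k') else s (0%N, g).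
have SS k : {homo S k : m n / (m < n)%N}.
  elim: k => [|k IH] m n mn /=; first exact: (sP _).1.
  by apply: IH; exact: (sP _).1.
have PS k : P k (g \o S k).
  case: k => [|k]; first exact: (sP (0%N, g)).2.
  exact: (sP (k.+1, g \o S k)).2.
have SDle k j : exists2 tau : nat -> nat,
    (forall n, (n <= tau n)%N) & S (k + j)%N =1 S k \o tau.
  elim: j => [|j [tau taun E]]; first by exists id => // n; rewrite addn0.
  exists (tau \o s ((k + j).+1, g \o S (k + j)%N)).
    move=> n /=; apply: leq_trans (taun _).
    by apply: increasing_leq; exact: (sP _).1.
  by move=> n; rewrite addnS /= E.
exists (fun n => S n n); split.
  apply: homo_ltn; first by move=> y x z; exact: ltn_trans.
  move=> n /=; apply: SS.
  exact: leq_trans (increasing_leq n.+1 (sP _).1).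
move=> k.
have /choice[tau tauP] (n : nat) : exists m,
    (k <= n)%N -> (n <= m)%N /\ S n n = S k m.
  have [kn|nk] := leqP k n; last by exists 0%N.
  have [tau taun E] := SDle k (n - k)%N; exists (tau n) => _.
  by have := E n; rewrite subnKC.
apply: (Psub k (g \o S k) _ tau k (PS k)) => n /tauP[ntau E].
by split => //=; rewrite E.
Qed.

Section ess_bounded.
Variables (R : realType) (X : normedModType R).
Local Notation mu := (@lebesgue_measure R).
Implicit Types u v : R -> X.

Let mu_gt0 : (0 < mu [set: R])%E.
Proof.
apply: (@lt_le_trans _ _ (mu `[0%R, 1%R]%classic)).
  by rewrite /= lebesgue_measure_itv/= lte_fin ltr01 oppr0 adde0 lte_fin.
by apply: le_measure; rewrite ?inE.
Qed.

Lemma Linfty_norm_leP u M : (Linfty_norm u <= M%:E)%E <->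
  \forall t \ae mu, `|u t| <= M.
Proof.
split=> [/ess_supP|uM].
  by apply: ae_imply => t; rewrite lee_fin.
by apply/ess_supP; apply: ae_imply uM => t uM; rewrite lee_fin.
Qed.

Lemma Linfty_norm_ge0 u : (0 <= Linfty_norm u)%E.
Proof. by apply: ess_sup_gee mu_gt0 _; apply: aeW => t; rewrite lee_fin. Qed.

Lemma Linfty_normE u : Linfty u -> Linfty_norm u = (fine (Linfty_norm u))%:E.
Proof. by move=> [_ uoo]; rewrite fineK// ge0_fin_numE// Linfty_norm_ge0. Qed.

Lemma Linfty_ae u : Linfty u ->
  \forall t \ae mu, `|u t| <= fine (Linfty_norm u).
Proof. by move=> /Linfty_normE uE; apply/Linfty_norm_leP; rewrite -uE. Qed.

Lemma LinftyP u : Linfty u <-> strongly_measurable u /\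
  exists M, \forall t \ae mu, `|u t| <= M.
Proof.
split=> [uL|[usm [M /Linfty_norm_leP uM]]].
  by split; [exact: uL.1|exists (fine (Linfty_norm u)); exact: Linfty_ae].
by split=> //; rewrite (le_lt_trans uM)// ltry.
Qed.

Lemma LinftyD u v : Linfty u -> Linfty v -> Linfty (fun t => u t + v t).
Proof.
move=> /LinftyP[usm [M uM]] /LinftyP[mv [K vK]]; apply/LinftyP; split.
  exact: strongly_measurableD.
exists (M + K); apply: ae_imply2 uM vK => t uM vK.
by rewrite (le_trans (ler_normD _ _))// lerD.
Qed.

Lemma LinftyZ a u : Linfty u -> Linfty (fun t => a *: u t).
Proof.
move=> /LinftyP[usm [M uM]]; apply/LinftyP; split.
  exact: strongly_measurableZ.
by exists (`|a| * M); apply: ae_imply uM => t uM; rewrite normrZ ler_wpM2l.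
Qed.

Lemma Linfty_normD u v : Linfty u -> Linfty v ->
  fine (Linfty_norm (fun t => u t + v t)) <=
  fine (Linfty_norm u) + fine (Linfty_norm v).
Proof.
move=> Lu Lv; rewrite -lee_fin -Linfty_normE; last exact: LinftyD.
apply/Linfty_norm_leP.
apply: ae_imply2 (Linfty_ae Lu) (Linfty_ae Lv) => t ut vt.
by rewrite (le_trans (ler_normD _ _))// lerD.
Qed.

Lemma Linfty_normZ a u : Linfty u ->
  fine (Linfty_norm (fun t => a *: u t)) = `|a| * fine (Linfty_norm u).
Proof.
have le b v : Linfty v ->
    fine (Linfty_norm (fun t => b *: v t)) <= `|b| * fine (Linfty_norm v).
  move=> Lv; rewrite -lee_fin -Linfty_normE; last exact: LinftyZ.
  apply/Linfty_norm_leP; apply: ae_imply (Linfty_ae Lv) => t vt.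
  by rewrite normrZ ler_wpM2l.
move=> Lu; apply/eqP; rewrite eq_le le//=.
have [->|a0] := eqVneq a 0.
  by rewrite normr0 mul0r fine_ge0// Linfty_norm_ge0.
have := le a^-1 _ (LinftyZ a Lu).
have -> : (fun t => a^-1 *: (a *: u t)) = u.
  by apply/funext => t; rewrite scalerA mulVf// scale1r.
by rewrite normfV -ler_pdivlMl ?invr_gt0 ?normr_gt0// invrK.
Qed.

Lemma Linfty_norm_eq0 u : Linfty u ->
  fine (Linfty_norm u) = 0 <-> \forall t \ae mu, u t = 0.
Proof.
move=> Lu; split=> [u0|u0].
  have := Linfty_ae Lu; rewrite u0.
  by apply: ae_imply => t; rewrite normr_le0 => /eqP.
apply/eqP; rewrite eq_le fine_ge0 ?Linfty_norm_ge0// andbT.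
rewrite -lee_fin -Linfty_normE//.
by apply/Linfty_norm_leP; apply: ae_imply u0 => t ->; rewrite normr0.
Qed.

End ess_bounded.

(** * Limits along translations *)

Section weyl_distance.
Variables (R : realType) (p : R) (X : normedModType R).
Hypothesis p1 : 1 <= p.
Local Notation mu := (@lebesgue_measure R).
Implicit Types u v w : R -> X.

Definition weyl_dist u v := weyl_norm p (fun t => u t - v t).

Lemma weyl_dist_ge0 u v : strongly_measurable u -> strongly_measurable v ->
  (0 <= weyl_dist u v)%E.
Proof.
by move=> usm mv; apply: weyl_norm_ge0 => //; exact: strongly_measurableB.
Qed.

Lemma weyl_dist_triangle v u w : strongly_measurable u ->
  strongly_measurable v -> strongly_measurable w ->
  (weyl_dist u w <= weyl_dist u v + weyl_dist v w)%E.
Proof.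
move=> usm mv mw; rewrite /weyl_dist.
have -> : (fun t => u t - w t) = (fun t => (u t - v t) + (v t - w t)).
  by apply/funext => t; rewrite addrA subrK.
by apply: weyl_normD => //; exact: strongly_measurableB.
Qed.

Lemma weyl_distC u v : strongly_measurable u -> strongly_measurable v ->
  weyl_dist u v = weyl_dist v u.
Proof.
have le u' v' : strongly_measurable u' -> strongly_measurable v' ->
    (weyl_dist u' v' <= weyl_dist v' u')%E.
  move=> usm mv; rewrite -[leRHS]mul1e; apply: weyl_norm_dominated => //.
  - exact: strongly_measurableB.
  - exact: strongly_measurableB.
  - by apply: aeW => t; rewrite mul1r distrC.
by move=> usm mv; apply/eqP; rewrite eq_le; apply/andP; split; exact: le.
Qed.

Lemma weyl_distD u u' v v' :
  strongly_measurable u -> strongly_measurable u' ->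
  strongly_measurable v -> strongly_measurable v' ->
  (weyl_dist (fun t => u t + v t)%R (fun t => u' t + v' t)%R <=
   weyl_dist u u' + weyl_dist v v')%E.
Proof.
move=> usm mu' mv mv'; rewrite /weyl_dist.
have -> : (fun t => u t + v t - (u' t + v' t)) =
    (fun t => (u t - u' t) + (v t - v' t)).
  by apply/funext => t; rewrite opprD addrACA.
by apply: weyl_normD => //; exact: strongly_measurableB.
Qed.

Lemma weyl_distB u u' v v' :
  strongly_measurable u -> strongly_measurable u' ->
  strongly_measurable v -> strongly_measurable v' ->
  (weyl_dist (fun t => u t - v t)%R (fun t => u' t - v' t)%R <=
   weyl_dist u u' + weyl_dist v v')%E.
Proof.
move=> usm mu' mv mv'; rewrite (weyl_distC mv mv') /weyl_dist.
have -> : (fun t => u t - v t - (u' t - v' t)) =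
    (fun t => (u t - u' t) + (v' t - v t)).
  by apply/funext => t; rewrite opprB (addrC (v' t)) addrACA (addrC (- v t)).
by apply: weyl_normD => //; exact: strongly_measurableB.
Qed.

Lemma weyl_dist_dominated K u u' v v' : 0 < K ->
  strongly_measurable u -> strongly_measurable u' ->
  strongly_measurable v -> strongly_measurable v' ->
  (\forall t \ae mu, `|u t - u' t| <= K * `|v t - v' t|) ->
  (weyl_dist u u' <= K%:E * weyl_dist v v')%E.
Proof.
by move=> *; apply: weyl_norm_dominated => //; exact: strongly_measurableB.
Qed.

Lemma weyl_dist_le_cst M u v : 0 <= M ->
  strongly_measurable u -> strongly_measurable v ->
  (\forall t \ae mu, `|u t - v t| <= M) -> (weyl_dist u v <= M%:E)%E.
Proof.
by move=> *; apply: weyl_norm_le_cst => //; exact: strongly_measurableB.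
Qed.

Lemma weyl_dist_shift c u v : strongly_measurable u -> strongly_measurable v ->
  weyl_dist (fun t => u (t + c)) (fun t => v (t + c)) = weyl_dist u v.
Proof.
move=> usm mv.
exact: (@weyl_norm_shift R p X (fun t => u t - v t) c
  (strongly_measurableB usm mv)).
Qed.

Lemma LplocD u v : Lploc p u -> Lploc p v -> Lploc p (fun t => u t + v t).
Proof.
move=> [usm ul] [mv vl]; split; first exact: strongly_measurableD.
move=> a b.
pose k := (1 + 1) `^ p * (1 / (1 + 1) / 1 `^ p).
have k0 : 0 <= k.
  by rewrite /k powR1 divr1 mulr_ge0 ?powR_ge0// divr_ge0.
apply: (@le_lt_trans _ _ (k%:E * power_integral p u a b +
   k%:E * power_integral p v a b)%E).
  apply: power_integral_le_lin => //; apply: aeW => t.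
  apply: (le_trans _ (powRD_le_lin p1 (normr_ge0 _) (normr_ge0 _) ltr01 ltr01)).
  by rewrite ge0_ler_powR ?nnegrE ?addr_ge0 ?ler_normD ?(le_trans ler01 p1).
by rewrite lte_add_pinfty// lte_mul_pinfty// ?lee_fin// ?ul ?vl.
Qed.

Lemma LplocZ (c : R) u : Lploc p u -> Lploc p (fun t => c *: u t).
Proof.
move=> [usm ul]; split; first exact: strongly_measurableZ.
move=> a b.
apply: (@le_lt_trans _ _ ((`|c| `^ p)%:E * power_integral p u a b +
   0%:E * power_integral p u a b)%E).
  apply: power_integral_le_lin => //; rewrite ?powR_ge0//; apply: aeW => t.
  by rewrite mul0r addr0 normrZ powRM.
by rewrite mul0e adde0 lte_mul_pinfty// ?lee_fin ?powR_ge0// ul.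
Qed.

Lemma Linfty_Lploc u : Linfty u -> Lploc p u.
Proof.
move=> /LinftyP[usm [M uM]]; split=> // a b.
have [ab|ba] := leP a b.
  apply: le_lt_trans (power_integral_le_cst _ ab uM) (ltry _).
  exact: le_trans p1.
by rewrite set_itv_ge ?integral_set0 ?ltry// bnd_simp -ltNge.
Qed.

Lemma Linfty_WpB u : Linfty u -> WpB p u.
Proof.
move=> uL; split; first exact: Linfty_Lploc.
have := Linfty_ae uL; have := Linfty_norm_ge0 u; case: uL => usm _.
move=> /fine_ge0 u0 uM.
exact: le_lt_trans (weyl_norm_le_cst p1 usm u0 uM) (ltry _).
Qed.

(** The relation between a function and its limit along translations in the
definition of Weyl almost automorphy. *)
Definition translation_limit u (gamma : nat -> R) u' :=
  [/\ Lploc p u',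
      vanishing (fun n => weyl_dist (fun t => u (t + gamma n)) u')
    & vanishing (fun n => weyl_dist (fun t => u' (t - gamma n)) u)].

(** Membership in the Weyl space comes from essential boundedness, which bounds
the Weyl means. *)
Lemma WWP u : WW p u <-> Linfty u /\
  forall gamma' : nat -> R, exists sigma : nat -> nat,
    {homo sigma : m n / (m < n)%N} /\
    exists u', translation_limit u (gamma' \o sigma) u'.
Proof.
have dists_ge0 (gamma : nat -> R) (u' : R -> X) : Linfty u -> Lploc p u' ->
    (forall n, (0 <= weyl_dist (fun t => u (t + gamma n)%R) u')%E) /\
    (forall n, (0 <= weyl_dist (fun t => u' (t - gamma n)%R) u)%E).
  move=> uL u'L; split=> n; apply: weyl_dist_ge0.
  - exact: strongly_measurable_shift uL.1.
  - exact: u'L.1.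
  - exact: strongly_measurable_shift u'L.1.
  - exact: uL.1.
split=> [[[_ uAA] uL]|[uL uAA]].
  split => // gamma'; have [sigma [sS [u' [u'L h1 h2]]]] := uAA gamma'.
  have [ge1 ge2] := dists_ge0 (gamma' \o sigma) _ uL u'L.
  exists sigma; split => //; exists u'; split => //.
  - exact: (proj1 (cvge0P ge1) h1).
  - exact: (proj1 (cvge0P ge2) h2).
split => //; split; first exact: Linfty_WpB.
move=> gamma'; have [sigma [sS [u' [u'L h1 h2]]]] := uAA gamma'.
have [ge1 ge2] := dists_ge0 (gamma' \o sigma) _ uL u'L.
exists sigma; split => //; exists u'; split => //.
- exact: (proj2 (cvge0P ge1) h1).
- exact: (proj2 (cvge0P ge2) h2).
Qed.

Lemma translation_limit_tail u u' gamma delta (tau : nat -> nat) N :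
  translation_limit u gamma u' ->
  (forall n, (N <= n)%N -> (n <= tau n)%N /\ delta n = gamma (tau n)) ->
  translation_limit u delta u'.
Proof.
move=> [u'L h1 h2] gd; split; first exact: u'L.
- by apply: vanishing_tail h1 => n /gd[ntau ->]; split; first exact: ntau.
- by apply: vanishing_tail h2 => n /gd[ntau ->]; split; first exact: ntau.
Qed.

Lemma translation_limit_sub u u' gamma (tau : nat -> nat) :
  {homo tau : m n / (m < n)%N} ->
  translation_limit u gamma u' -> translation_limit u (gamma \o tau) u'.
Proof.
move=> tS ug; apply: (@translation_limit_tail _ _ _ _ tau 0%N ug) => n _.
by split; first exact: increasing_leq.
Qed.

Lemma translation_limitD u u' v v' gamma :
  strongly_measurable u -> strongly_measurable v ->
  translation_limit u gamma u' -> translation_limit v gamma v' ->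
  translation_limit (fun t => u t + v t) gamma (fun t => u' t + v' t).
Proof.
move=> usm mv [u'L u1 u2] [v'L v1 v2]; split; first exact: LplocD.
- apply: vanishingD u1 v1 => n; apply: weyl_distD;
    try exact: strongly_measurable_shift.
    exact: u'L.1.
  exact: v'L.1.
- by apply: vanishingD u2 v2 => n; apply: weyl_distD => //;
    apply: strongly_measurable_shift; [exact: u'L.1|exact: v'L.1].
Qed.

Lemma translation_limitZ a u u' gamma : strongly_measurable u ->
  translation_limit u gamma u' ->
  translation_limit (fun t => a *: u t) gamma (fun t => a *: u' t).
Proof.
move=> usm [u'L u1 u2].
(* A positive factor is used, so that [a = 0] is no exception. *)
have K0 : 0 < `|a| + 1 by rewrite ltr_wpDl.
have aE x y : `|a *: x - a *: y| <= (`|a| + 1) * `|x - y :> X|.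
  by rewrite -scalerBr normrZ ler_wpM2r// lerDl.
split; first exact: LplocZ.
- apply: (vanishingZ K0) u1 => n.
  have mu' := u'L.1; have mc := strongly_measurable_shift (gamma n) usm.
  apply: (weyl_dist_dominated K0) => //; try exact: strongly_measurableZ.
  by apply: aeW => t; exact: aE.
- apply: (vanishingZ K0) u2 => n.
  have mc := strongly_measurable_shift (- gamma n) u'L.1.
  apply: (weyl_dist_dominated K0) => //; try exact: strongly_measurableZ.
  by apply: aeW => t; exact: aE.
Qed.

Lemma WW0 : WW p (fun=> 0 : X).
Proof.
have m0 : strongly_measurable (fun=> 0 : X) by exact: strongly_measurable_cst.
have L0 : Linfty (fun=> 0 : X).
  by apply/LinftyP; split => //; exists 0; apply: aeW => t; rewrite normr0.
apply/WWP; split => // gamma'; exists id; split => //; exists (fun=> 0).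
have v0 : vanishing (fun=> weyl_dist (fun=> 0 : X) (fun=> 0)).
  move=> e e0; exists 0%N => n _; apply: (@le_trans _ _ 0%:E); last first.
    by rewrite lee_fin ltW.
  by apply: weyl_dist_le_cst => //; apply: aeW => t; rewrite subrr normr0.
by split => //; exact: Linfty_Lploc.
Qed.

Lemma WWD u v : WW p u -> WW p v -> WW p (fun t => u t + v t).
Proof.
move=> /WWP[uL uAA] /WWP[vL vAA]; apply/WWP; split; first exact: LinftyD.
move=> gamma'.
have [s [sS [u' us]]] := uAA gamma'.
have [r [rS [v' vr]]] := vAA (gamma' \o s).
exists (s \o r); split; first by move=> m n mn; apply: sS; exact: rS.
exists (fun t => u' t + v' t).
apply: translation_limitD; [exact: uL.1|exact: vL.1| |exact: vr].
exact: (translation_limit_sub rS us).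
Qed.

Lemma WWZ a u : WW p u -> WW p (fun t => a *: u t).
Proof.
move=> /WWP[uL uAA]; apply/WWP; split; first exact: LinftyZ.
move=> gamma'; have [s [sS [u' us]]] := uAA gamma'.
exists s; split => //; exists (fun t => a *: u' t).
by apply: translation_limitZ => //; exact: uL.1.
Qed.

End weyl_distance.

(** * Completeness *)

Section completeness.
Variables (R : realType) (p : R) (X : completeNormedModType R).
Hypothesis p1 : 1 <= p.
Local Notation mu := (@lebesgue_measure R).

(** The function [u' - v'] is the Weyl limit of the translates of [u - v],
which take their values in the ball of radius [M] almost everywhere, and
retracting a value of [u' - v'] moves it by no more than its distance to the
value of a translate. Hence the Weyl distance on the left is at most the
distances from [u' - v'] to the translates, which tend to 0. *)
Lemma translation_limit_truncate (u v u' v' : R -> X) gamma M : 0 < M ->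
  strongly_measurable u -> strongly_measurable v ->
  (\forall t \ae mu, `|u t - v t| <= M) ->
  translation_limit p u gamma u' -> translation_limit p v gamma v' ->
  weyl_dist p (fun t => u' t - v' t) (fun t => radial M (u' t - v' t)) = 0%E.
Proof.
move=> M0 usm mv uvM [[mu' _] uu' _] [[mv' _] vv' _].
have md : strongly_measurable (fun t => u' t - v' t).
  exact: strongly_measurableB.
have mr : strongly_measurable (fun t => radial M (u' t - v' t)).
  exact: strongly_measurable_radial.
apply/eqP; rewrite eq_le weyl_dist_ge0// andbT; apply/lee_addgt0Pr => e e0.
rewrite add0e.
have e2 : 0 < e / 2 by rewrite divr_gt0.
have [n0 hn0] := uu' _ e2; have [n1 hn1] := vv' _ e2.
pose n := maxn n0 n1.
have mun := strongly_measurable_shift (gamma n) usm.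
have mvn := strongly_measurable_shift (gamma n) mv.
have mw : strongly_measurable (fun t => u (t + gamma n) - v (t + gamma n)).
  exact: strongly_measurableB mun mvn.
apply: (@le_trans _ _ (1%:E * weyl_dist p (fun t => u' t - v' t)%R
    (fun t => u (t + gamma n) - v (t + gamma n))%R)%E).
  apply: weyl_dist_dominated => //.
  apply: ae_imply (ae_shift (gamma n) uvM) => t wM.
  by rewrite mul1r; exact: radial_dist.
rewrite mul1e weyl_distC//.
apply: le_trans (weyl_distB p1 mun mu' mvn mv') _.
rewrite (splitr e) EFinD leeD//; [apply: hn0|apply: hn1].
  exact: leq_maxl.
exact: leq_maxr.
Qed.

Section completeness_step.
Variable v_ : nat -> R -> X.
Hypothesis vW : forall k, WW p (v_ k).
Hypothesis vS : forall k,
  \forall t \ae mu, `|v_ k.+1 t - v_ k t| <= 2^-1 ^+ k.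

Let vL k : Linfty (v_ k).
Proof. by have /(WWP p1)[] := vW k. Qed.

Let mv k : strongly_measurable (v_ k).
Proof. by have [] := vL k. Qed.

Definition ae_limit t : X := limn (fun k => v_ k t).

Lemma ae_limit_dist :
  \forall t \ae mu, forall k, `|v_ k t - ae_limit t| <= 2 * 2^-1 ^+ k.
Proof.
have := ae_foralln vS; apply: ae_imply => t vSt.
exact: (rapid_cvg vSt).2.
Qed.

Let ae_limit_distk k :
  \forall t \ae mu, `|v_ k t - ae_limit t| <= 2 * 2^-1 ^+ k.
Proof. by apply: ae_imply ae_limit_dist => t; exact. Qed.

Lemma ae_limit_Linfty : Linfty ae_limit.
Proof.
apply/LinftyP; split.
  apply: (@strongly_measurable_unif_lim _ _ (fun k => v_ k.+1)) => // k.
  apply: ae_imply (ae_limit_distk k.+1) => t.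
  by rewrite exprS mulrA divff// mul1r.
have /LinftyP[_ [M vM]] := vL 0.
exists (M + 2); apply: ae_imply2 vM (ae_limit_distk 0) => t vM.
rewrite expr0 mulr1 distrC => vl.
rewrite -(subrK (v_ 0%N t) (ae_limit t)) addrC.
by rewrite (le_trans (ler_normD _ _))// lerD.
Qed.

Let ml : strongly_measurable ae_limit := ae_limit_Linfty.1.

Section limit_of_limits.
Variables (gamma : nat -> R) (v'_ : nat -> R -> X).
Hypothesis vv' : forall k, translation_limit p (v_ k) gamma (v'_ k).

(** The telescoping sum of the differences of the limits [v'_], with each
difference retracted onto the ball that contains almost every value of the
corresponding difference of the [v_]. *)
Fixpoint corrected k t : X := if k is k'.+1
  then corrected k' t + radial (2^-1 ^+ k') (v'_ k'.+1 t - v'_ k' t)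
  else v'_ 0%N t.

Let mv' k : strongly_measurable (v'_ k).
Proof. by have [[]] := vv' k. Qed.

Let mr k : strongly_measurable
  (fun t => radial (2^-1 ^+ k) (v'_ k.+1 t - v'_ k t)).
Proof.
apply: strongly_measurable_radial; first by rewrite exprn_gt0.
exact: strongly_measurableB.
Qed.

Let mc k : strongly_measurable (corrected k).
Proof. by elim: k => [|k IH] /=; [exact: mv'|exact: strongly_measurableD]. Qed.

Let corrected_dist k : weyl_dist p (v'_ k) (corrected k) = 0%E.
Proof.
elim: k => [|k IH].
  apply/eqP; rewrite eq_le (weyl_dist_ge0 p1 (mv' 0) (mc 0)) andbT.
  apply: (weyl_dist_le_cst p1 (lexx 0) (mv' 0) (mc 0)).
  by apply: aeW => t; rewrite /= subrr normr0.
apply/eqP; rewrite eq_le (weyl_dist_ge0 p1 (mv' k.+1) (mc k.+1)) andbT.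
have e0 : 0 < 2^-1 ^+ k :> R by rewrite exprn_gt0.
have tr := translation_limit_truncate e0 (mv k.+1) (mv k) (vS k)
  (vv' k.+1) (vv' k).
have -> : v'_ k.+1 = (fun t => v'_ k t + (v'_ k.+1 t - v'_ k t)).
  by apply/funext => t; rewrite addrC subrK.
apply: le_trans (weyl_distD p1 (mv' k) (mc k) _ (mr k)) _.
  exact: strongly_measurableB.
by rewrite IH add0e; move: tr => ->.
Qed.

Let correctedS k t : `|corrected k.+1 t - corrected k t| <= 2^-1 ^+ k.
Proof.
by rewrite /= addrAC subrr add0r; apply: radial_le; rewrite exprn_gt0.
Qed.

Definition corrected_limit t : X := limn (fun k => corrected k t).

Let corrected_limit_dist k t :
  `|corrected k t - corrected_limit t| <= 2 * 2^-1 ^+ k.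
Proof. exact: (rapid_cvg (fun k => correctedS k t)).2. Qed.

Let mcl : strongly_measurable corrected_limit.
Proof.
apply: (@strongly_measurable_unif_lim _ _ (fun k => corrected k.+1)) => // k.
apply: aeW => t; have := corrected_limit_dist k.+1 t.
by rewrite exprS mulrA divff// mul1r.
Qed.

(** The first limit is only locally p-integrable, but the corrections add up to
a bounded function. *)
Lemma corrected_limit_Lploc : Lploc p corrected_limit.
Proof.
have -> : corrected_limit =
    (fun t => v'_ 0%N t + (corrected_limit t - corrected 0 t)).
  by apply/funext => t; rewrite addrC subrK.
apply: (LplocD p1); first by have [] := vv' 0.
apply: (Linfty_Lploc p1); apply/LinftyP.
split; first exact: strongly_measurableB.
exists 2; apply: aeW => t; have := corrected_limit_dist 0 t.
by rewrite distrC expr0 mulr1.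
Qed.

(** In both directions the distance is split at [v_ k], [v'_ k] and
[corrected k]: the outer distances are at most [2 * 2^-k] by uniform
convergence, [v'_ k] and [corrected k] are at distance 0, and for fixed [k]
the remaining distance tends to 0 as [n] tends to infinity. *)
Lemma translation_limit_ae_limit :
  translation_limit p ae_limit gamma corrected_limit.
Proof.
split; first exact: corrected_limit_Lploc.
- move=> e e0.
  have [|k hk] := @half_expn_le R (e / 6); first by rewrite divr_gt0.
  have {hk}ke : 2 * 2^-1 ^+ k <= e / 3 :> R by have := hk k (leqnn k); lra.
  have [_ h _] := vv' k; have [|n0 hn0] := h (e / 3); first by rewrite divr_gt0.
  exists n0 => n /hn0 dn.
  have msl := strongly_measurable_shift (gamma n) ml.
  have msv := strongly_measurable_shift (gamma n) (mv k).
  apply: le_trans (weyl_dist_triangle p1 msl msv mcl) _.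
  apply: le_trans (leeD (lexx _) (weyl_dist_triangle p1 msv (mv' k) mcl)) _.
  apply: le_trans (leeD (lexx _) (leeD (lexx _)
    (weyl_dist_triangle p1 (mv' k) (mc k) mcl))) _.
  rewrite corrected_dist add0e.
  have -> : e = e / 3 + (e / 3 + e / 3) by field.
  rewrite [leRHS]EFinD [X in (_ <= _ + X)%E]EFinD.
  apply: leeD; last apply: leeD; [|exact: dn|].
    rewrite (weyl_dist_shift p (gamma n) ml (mv k)).
    apply: weyl_dist_le_cst => //; first by rewrite divr_ge0// ltW.
    by apply: ae_imply (ae_limit_distk k) => t /le_trans; rewrite distrC; apply.
  apply: weyl_dist_le_cst => //; first by rewrite divr_ge0// ltW.
  by apply: aeW => t; apply: le_trans (corrected_limit_dist k t) _.
- move=> e e0.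
  have [|k hk] := @half_expn_le R (e / 6); first by rewrite divr_gt0.
  have {hk}ke : 2 * 2^-1 ^+ k <= e / 3 :> R by have := hk k (leqnn k); lra.
  have [_ _ h] := vv' k; have [|n0 hn0] := h (e / 3); first by rewrite divr_gt0.
  exists n0 => n /hn0 dn.
  have mscl := strongly_measurable_shift (- gamma n) mcl.
  have msc := strongly_measurable_shift (- gamma n) (mc k).
  have msv' := strongly_measurable_shift (- gamma n) (mv' k).
  apply: le_trans (weyl_dist_triangle p1 mscl msc ml) _.
  apply: le_trans (leeD (lexx _) (weyl_dist_triangle p1 msc msv' ml)) _.
  apply: le_trans (leeD (lexx _) (leeD (lexx _)
    (weyl_dist_triangle p1 msv' (mv k) ml))) _.
  rewrite (weyl_dist_shift p (- gamma n) (mc k) (mv' k)).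
  rewrite (weyl_distC p1 (mc k) (mv' k)) corrected_dist add0e.
  have -> : e = e / 3 + (e / 3 + e / 3) by field.
  rewrite [leRHS]EFinD [X in (_ <= _ + X)%E]EFinD.
  apply: leeD; last apply: leeD; [|exact: dn|].
    rewrite (weyl_dist_shift p (- gamma n) mcl (mc k)).
    apply: weyl_dist_le_cst => //; first by rewrite divr_ge0// ltW.
    apply: aeW => t; rewrite distrC.
    exact: le_trans (corrected_limit_dist k t) _.
  apply: weyl_dist_le_cst => //; first by rewrite divr_ge0// ltW.
  by apply: ae_imply (ae_limit_distk k) => t /le_trans; apply.
Qed.

End limit_of_limits.

Lemma ae_limit_WW : WW p ae_limit.
Proof.
apply/(WWP p1); split; first exact: ae_limit_Linfty.
move=> gamma'.
have [||s [sS sP]] := @diagonal_extraction R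
  (fun k g => exists u', translation_limit p (v_ k) g u') _ _ gamma'.
- by move=> k g; have /(WWP p1)[_] := vW k; apply.
- move=> k g g' tau N [u' ug] gg'; exists u'.
  exact: (translation_limit_tail ug gg').
have /choice[v' vv'] := sP.
exists s; split => //; exists (corrected_limit v').
exact: translation_limit_ae_limit.
Qed.

Lemma ae_limit_cvg e : 0 < e -> exists n0, forall n, (n0 <= n)%N ->
  (Linfty_norm (fun t => v_ n t - ae_limit t)%R <= e%:E)%E.
Proof.
move=> e0; have [|n0 hn0] := @half_expn_le R (e / 2); first by rewrite divr_gt0.
exists n0 => n /hn0 ne; apply/Linfty_norm_leP.
by apply: ae_imply (ae_limit_distk n) => t /le_trans; apply; lra.
Qed.

End completeness_step.

End completeness.

Theorem theorem2p5 (R : realType) (X : completeNormedModType R) (p : R)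
    (hp : 1 <= p) :
  is_banach_modulo_ae (@WW R X p) (@Linfty_norm R X).
Proof.
have WL u : @WW R X p u -> Linfty u by move=> /(WWP hp)[].
have SB (u v : R -> X) : WW p u -> WW p v -> WW p (u - v).
  move=> Wu Wv; apply: (WWD hp Wu).
  have -> : - v = (fun t => -1 *: v t) by apply/funext => t; rewrite scaleN1r.
  exact: WWZ.
split; [exact: WW0|by move=> u v; exact: WWD|by move=> a u; exact: WWZ|].
have [||||||E [q [qD qZ qsurj qnorm]]] := @seminorm_quotient_complete R (R -> X)
  (@WW R X p) (fun u => fine (Linfty_norm u)).
- exact: WW0.
- by move=> u v; exact: WWD.
- by move=> a u; exact: WWZ.
- by move=> u v /WL Lu /WL Lv; exact: Linfty_normD.
- by move=> a u /WL Lu; exact: Linfty_normZ.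
- move=> v_ vW vS.
  have vS' k : \forall t \ae (@lebesgue_measure R),
      `|v_ k.+1 t - v_ k t| <= 2^-1 ^+ k.
    have L := WL _ (SB _ _ (vW k.+1) (vW k)).
    by apply: ae_imply (Linfty_ae L) => t /le_trans; apply; exact: vS.
  exists (ae_limit v_); first exact: ae_limit_WW.
  move=> e /(ae_limit_cvg vS')[n0 hn0]; exists n0 => n /hn0.
  have L := WL _ (SB _ _ (vW n) (ae_limit_WW hp vW vS')).
  by rewrite [X in (X <= _)%E](Linfty_normE L) lee_fin.
exists E, q; split.
- exact: qD.
- exact: qZ.
- move=> u v Wu Wv.
  have L := WL _ (SB _ _ Wu Wv).
  have qB : q u - q v = q (u - v).
    have Wv' : WW p (-1 *: v) := WWZ hp (-1) Wv.
    have -> : u - v = u + -1 *: v by rewrite scaleN1r.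
    by rewrite qD// qZ// scaleN1r.
  have qE : `|q u - q v| = fine (Linfty_norm (u - v)).
    by rewrite qB; apply: qnorm; exact: SB.
  split=> [quv|uv].
    have /(Linfty_norm_eq0 L) : fine (Linfty_norm (u - v)) = 0.
      by rewrite -qE quv subrr normr0.
    by apply: ae_imply => t /eqP; rewrite subr_eq0 => /eqP.
  apply/eqP; rewrite -subr_eq0 -normr_eq0 qE; apply/eqP/(Linfty_norm_eq0 L).
  by apply: ae_imply uv => t uvt; apply/eqP; rewrite subr_eq0 uvt.
- exact: qsurj.
- by move=> u Wu; rewrite qnorm//; exact/esym/Linfty_normE/WL.
Qed.
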